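(* For every $i\ge0$: $\nu(Z_{i,1}(d_{i,1}))=0$; $$\nu(Z_{i,1}(d_{i,1}+1))\ \begin{cases}=1,& i\equiv 1\pmod 4,\\ \ge 2,& i\not\equiv 1\pmod 4;\end{cases}$$ and for every $M\ge2$, $\nu(Z_{i,1}(d_{i,1}+M))\ge M+1$.
   Context: Let $E(q)=\prod_{m\ge1}(1-q^m)$. Define $$\gamma(q)=\frac{E(q)^5E(q^2)^5E(q^6)^5}{E(q^3)^{15}},\quad \xi=\xi(q)=\frac{E(q^2)^5E(q^6)}{E(q)E(q^3)^5},\quad \kappa(q)=\frac{\gamma(q^2)^2}{\gamma(q)},$$ and let $U\left(\sum_n a_nq^n\right)=\sum_n a_{2n}q^n$. For $i,j\ge0$, $\zeta_{i,j}=U(\kappa^i\xi^j)$, which equals a polynomial in $\xi$ with integer coefficients; write $\zeta_{i,j}=\sum_m Z_{i,j}(m)\xi^m$. Define $d_{i,j}=5I+J$ if $(i,j)=(2I,2J)$; $5I+J+1$ if $(i,j)=(2I,2J+1)$; $5I+J+3$ if $(i,j)=(2I+1,2J)$ or $(2I+1,2J+1)$. $\nu(n)$ is the $2$-adic valuation of an integer $n$, with $\nu(0)=\infty$. *)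

(* Defs.v *)
From mathcomp Require Import all_boot all_order all_algebra.
Set Implicit Arguments. Unset Strict Implicit. Unset Printing Implicit Defensive.
Import Order.TTheory GRing.Theory Num.Theory.
Local Open Scope ring_scope.

Definition ser := nat -> int.

Definition sOne : ser := fun n => (n == 0%N)%:Z.
Definition sSub (f g : ser) : ser := fun n => f n - g n.
Definition sMul (f g : ser) : ser :=
  fun n => \sum_(k < n.+1) f k * g (n - k)%N.
Definition sExp (f : ser) (e : nat) : ser := iter e (sMul f) sOne.
(* inverse of a series with constant term 1:  1/f = sum_k (1 - f)^k ;
   the coefficient of q^n only receives contributions from k <= n. *)
Definition sInv (f : ser) : ser :=
  fun n => \sum_(k < n.+1) sExp (sSub sOne f) k n.
Definition sDil (k : nat) (f : ser) : ser :=
  fun n => if (k %| n)%N then f (n %/ k)%N else 0.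
Definition sU (f : ser) : ser := fun n => f (2 * n)%N.

(* E(q) = prod_{m >= 1} (1 - q^m); the coefficient of q^n only depends
   on the factors with m <= n. *)
Definition Eser : ser :=
  fun n => (\prod_(1 <= m < n.+1) (1 - 'X^m : {poly int}))`_n.
Definition E_ (k : nat) : ser := sDil k Eser.

Definition gamma : ser :=
  sMul (sMul (sMul (sExp (E_ 1) 5) (sExp (E_ 2) 5)) (sExp (E_ 6) 5))
       (sInv (sExp (E_ 3) 15)).
Definition xi : ser :=
  sMul (sMul (sExp (E_ 2) 5) (E_ 6)) (sInv (sMul (E_ 1) (sExp (E_ 3) 5))).
Definition kappa : ser := sMul (sExp (sDil 2 gamma) 2) (sInv gamma).

Definition sEvalPoly (p : {poly int}) (f : ser) : ser :=
  fun n => \sum_(m < size p) p`_m * sExp f m n.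

(* p represents zeta_{i,j} = U(kappa^i xi^j) as a polynomial in xi,
   i.e. Z_{i,j}(m) = p`_m. *)
Definition zeta_rep (i j : nat) (p : {poly int}) : Prop :=
  forall n, sU (sMul (sExp kappa i) (sExp xi j)) n = sEvalPoly p xi n.

Definition d_ij (i j : nat) : nat :=
  if ~~ odd i then (5 * i./2 + j./2 + odd j)%N
  else (5 * i./2 + j./2 + 3)%N.

(* 2-adic valuation, None = infinity (for 0) *)
Definition nu (n : int) : option nat :=
  if n == 0 then None else Some (logn 2 `|n|%N).
Definition nu_ge (n : int) (k : nat) : Prop :=
  match nu n with None => True | Some v => (k <= v)%N end.

(* Main.v *)
From HB Require Import structures.
Require Import Defs.
From mathcomp Require Import all_boot all_order all_algebra all_field.
From mathcomp Require Import boolp zify ring.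
Set Implicit Arguments. Unset Strict Implicit. Unset Printing Implicit Defensive.
Import Order.TTheory GRing.Theory Num.Theory.
Local Open Scope ring_scope.

(** Put [t = q psi(q^6)^2 / psi(q^2)^2], a Hauptmodul of level 12 that is odd in
[q]. The identities [kappa = (1 - t)^-5], [xi = (1 + 3 t) / (1 + t)^2] and
[xi(q^2) = 1 / (1 - t^2)] turn [U] into taking even parts in [t]. With
[x = xi(q^2)] and [m = x (1 + t)^2] one has [m(t) m(-t) = 1] and
[m(t) + m(-t) = 4 x - 2], so up to a power of [x] the polynomials in question
satisfy [r_(k+2) = (4 x - 2) r_(k+1) - r_k]: they are polynomials in [4 x], up to
a factor 2, and this gives the valuations.

The identities rest on two cubic relations of level 6. The 3-dissections of
[psi(q)] and [phi(-q)] read [theta = a + b] with [a] in the powers of [q^3] and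
[b] in [q] times such powers; multiplying over [q -> w^i q], [w^3 = 1], gives
[a^3 + b^3] on the right and, by the Jacobi triple product, an eta quotient on
the left. Passing from level 6 to level 12 is algebraic: the level 6 relations at
[q] and at [q^2] give a cubic equation for [g(q) - g(-q)], with [g] the eta
quotient such that [g(-q)^-5 = kappa], and its only power series solution is
[2 t]; hence [g = 1 + t]. *)

(** * Formal power series *)

Definition fps (R : Type) : Type := nat -> R.

HB.instance Definition _ (R : Type) := gen_eqMixin (fps R).
HB.instance Definition _ (R : Type) := gen_choiceMixin (fps R).

Section FpsRing.
Variable R : comNzRingType.
Implicit Types f g h : fps R.

Definition fps_zero : fps R := fun=> 0.
Definition fps_one : fps R := fun n => (n == 0%N)%:R.
Definition fps_opp f : fps R := fun n => - f n.
Definition fps_add f g : fps R := fun n => f n + g n.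
Definition fps_mul f g : fps R :=
  fun n => \sum_(k < n.+1) f k * g (n - k)%N.

Lemma fps_addA : associative fps_add.
Proof. by move=> f g h; apply: funext => n; rewrite /fps_add addrA. Qed.
Lemma fps_addC : commutative fps_add.
Proof. by move=> f g; apply: funext => n; rewrite /fps_add addrC. Qed.
Lemma fps_add0 : left_id fps_zero fps_add.
Proof. by move=> f; apply: funext => n; rewrite /fps_add add0r. Qed.
Lemma fps_addN : left_inverse fps_zero fps_opp fps_add.
Proof. by move=> f; apply: funext => n; rewrite /fps_add addNr. Qed.

HB.instance Definition _ := GRing.isZmodule.Build (fps R)
  fps_addA fps_addC fps_add0 fps_addN.

Definition fps_of_poly (p : {poly R}) : fps R := fun n => p`_n.
Definition trunc N f : {poly R} := \poly_(i < N) f i.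

(** Congruence modulo [q^N]. Series identities are proved modulo every [q^N], where a series may be
    replaced by a polynomial and an infinite product by a finite one. *)
Definition eqX N f g := forall n, (n < N)%N -> f n = g n.

Lemma eqX_refl N f : eqX N f f.
Proof. by []. Qed.

Lemma eqX_sym N f g : eqX N f g -> eqX N g f.
Proof. by move=> E n /E. Qed.
Lemma eqX_trans N f g h : eqX N f g -> eqX N g h -> eqX N f h.
Proof. by move=> E1 E2 n nN; rewrite E1 ?E2. Qed.
Lemma eqXP f g : (forall N, eqX N f g) -> f = g.
Proof. by move=> E; apply: funext => n; apply: (E n.+1). Qed.

Lemma eqX_fps_mul N f f' g g' :
  eqX N f f' -> eqX N g g' -> eqX N (fps_mul f g) (fps_mul f' g').
Proof.
move=> Ef Eg n nN; apply: eq_bigr => k _; rewrite Ef ?Eg //.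
  by apply: leq_ltn_trans nN; rewrite leq_subr.
by apply: leq_ltn_trans nN; rewrite -ltnS.
Qed.

Lemma eqX_trunc N f : eqX N f (fps_of_poly (trunc N f)).
Proof. by move=> n nN; rewrite /fps_of_poly coef_poly nN. Qed.

Arguments eqX_trunc : clear implicits.

Lemma fps_mul_poly p q :
  fps_mul (fps_of_poly p) (fps_of_poly q) = fps_of_poly (p * q).
Proof. by apply: funext => n; rewrite /fps_of_poly coefM. Qed.

Lemma fps_mulA : associative fps_mul.
Proof.
move=> f g h; apply: eqXP => N.
have [[Ef Eg] Eh] := (eqX_trunc N f, eqX_trunc N g, eqX_trunc N h).
apply: eqX_trans (eqX_fps_mul Ef (eqX_fps_mul Eg Eh)) _.
apply: eqX_trans (eqX_sym (eqX_fps_mul (eqX_fps_mul Ef Eg) Eh)).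
by rewrite !fps_mul_poly mulrA.
Qed.

Lemma fps_mulC : commutative fps_mul.
Proof.
move=> f g; apply: eqXP => N.
have [Ef Eg] := (eqX_trunc N f, eqX_trunc N g).
apply: eqX_trans (eqX_fps_mul Ef Eg) _.
by apply: eqX_trans (eqX_sym (eqX_fps_mul Eg Ef)); rewrite !fps_mul_poly mulrC.
Qed.

Lemma fps_mul1 : left_id fps_one fps_mul.
Proof.
move=> f; apply: funext => n; rewrite /fps_mul big_ord_recl subn0 mul1r.
by rewrite big1 ?addr0 // => i _; rewrite mul0r.
Qed.

Lemma fps_mulDl : left_distributive fps_mul fps_add.
Proof.
move=> f g h; apply: funext => n; rewrite /fps_mul /fps_add -big_split /=.
by apply: eq_bigr => i _; rewrite mulrDl.
Qed.

Lemma fps_one_neq0 : fps_one != fps_zero.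
Proof.
by apply/eqP => /(congr1 (fun f : fps R => f 0%N)) /eqP; rewrite oner_eq0.
Qed.

HB.instance Definition _ := GRing.Zmodule_isComNzRing.Build (fps R)
  fps_mulA fps_mulC fps_mul1 fps_mulDl fps_one_neq0.

(** Units are defined by the existence of an inverse, which classical choice then picks; outside the
    units the inverse is the identity, as the unit ring interface demands. *)
Definition fps_unit f : bool := `[< exists g, g * f = 1 >].
Definition fps_inv f : fps R :=
  if pselect (exists g, g * f = 1) is left e then sval (cid e) else f.

Lemma fps_mulV : {in fps_unit, left_inverse 1 fps_inv *%R}.
Proof.
move=> f /asboolP uf; rewrite /fps_inv; case: pselect => // e.
exact: (svalP (cid e)).
Qed.
Lemma fps_unitP f g : g * f = 1 -> fps_unit f.
Proof. by move=> gf; apply/asboolP; exists g. Qed.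
Lemma fps_inv_out : {in [predC fps_unit], fps_inv =1 id}.
Proof.
move=> f; rewrite inE /= => /asboolP uf; rewrite /fps_inv.
by case: pselect.
Qed.

HB.instance Definition _ := GRing.ComNzRing_hasMulInverse.Build (fps R)
  fps_mulV fps_unitP fps_inv_out.

End FpsRing.
Arguments eqX_trunc {R} N f.

Lemma fps_coefD (R : comNzRingType) (f g : fps R) n : (f + g) n = f n + g n.
Proof. by []. Qed.
Lemma fps_coefN (R : comNzRingType) (f : fps R) n : (- f) n = - f n.
Proof. by []. Qed.
Lemma fps_coef0 (R : comNzRingType) n : (0 : fps R) n = 0.
Proof. by []. Qed.
Lemma fps_coef1 (R : comNzRingType) n : (1 : fps R) n = (n == 0%N)%:R.
Proof. by []. Qed.
Lemma fps_coefM (R : comNzRingType) (f g : fps R) n :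
  (f * g) n = \sum_(k < n.+1) f k * g (n - k)%N.
Proof. by []. Qed.
Lemma fps_coefM0 (R : comNzRingType) (f g : fps R) :
  (f * g) 0%N = f 0%N * g 0%N.
Proof. by rewrite fps_coefM big_ord1. Qed.
Lemma fps_coefX0 (R : comNzRingType) (f : fps R) k : (f ^+ k) 0%N = f 0%N ^+ k.
Proof. by elim: k => // k IH; rewrite !exprS fps_coefM0 IH. Qed.

(** If [f i] and [g j] are the lowest nonzero coefficients, the product has coefficient [f i * g j]
    at [i + j]. *)
Lemma fps_domain (R : idomainType) (f g : fps R) :
  f * g = 0 -> (f == 0) || (g == 0).
Proof.
move=> fg0; apply/orP/asboolP; case: (pselect (f = 0)) => [->|nf].
  by apply/asboolP; left.
case: (pselect (g = 0)) => [->|ng]; first by apply/asboolP; right.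
have low (h : fps R) : h <> 0 -> exists k, h k != 0 /\ forall j, (j < k)%N -> h j = 0.
  move=> nh; have ex : exists k, h k != 0.
    apply: contrapT => nex; apply: nh; apply: funext => k.
    by apply/eqP/negPn/negP => hk; apply: nex; exists k.
  case: (ex_minnP ex) => k hk mk; exists k; split=> // j jk.
  by apply/eqP; apply: contraTT jk => /mk; rewrite -leqNgt.
have [i [fi fj]] := low f nf; have [j [gj gk]] := low g ng.
have : (f * g) (i + j)%N = f i * g j.
  rewrite fps_coefM (bigD1 (Ordinal (leq_addr j i : (i < (i + j).+1)%N))) //=.
  rewrite addKn big1 ?addr0 // => k ki.
  have {ki}: (k : nat) != i by apply: contra ki => /eqP ki; apply/eqP/val_inj.
  rewrite neq_ltn => /orP[/fj -> | ik]; first by rewrite mul0r.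
  by rewrite [X in _ * X]gk ?mulr0 //; have := ltn_ord k; lia.
by rewrite fg0 fps_coef0 => /esym /eqP; rewrite mulf_eq0 (negPf fi) (negPf gj).
Qed.

HB.instance Definition _ (R : idomainType) :=
  GRing.ComUnitRing_isIntegral.Build (fps R) (@fps_domain R).

Local Notation "f =[ N ] g" := (eqX N f g) (at level 70).

Section FpsTheory.
Variable R : comNzRingType.
Implicit Types f g h : fps R.

Lemma eqXD N f f' g g' : f =[N] f' -> g =[N] g' -> f + g =[N] f' + g'.
Proof. by move=> Ef Eg n nN; rewrite !fps_coefD Ef ?Eg. Qed.
Lemma eqXM N f f' g g' : f =[N] f' -> g =[N] g' -> f * g =[N] f' * g'.
Proof. exact: eqX_fps_mul. Qed.
Lemma eqX_sum N I (r : seq I) (P : pred I) (F G : I -> fps R) :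
  (forall i, P i -> F i =[N] G i) ->
  \sum_(i <- r | P i) F i =[N] \sum_(i <- r | P i) G i.
Proof. by move=> E; elim/big_ind2: _ => // *; apply: eqXD. Qed.
Lemma eqX_prod N I (r : seq I) (P : pred I) (F G : I -> fps R) :
  (forall i, P i -> F i =[N] G i) ->
  \prod_(i <- r | P i) F i =[N] \prod_(i <- r | P i) G i.
Proof. by move=> E; elim/big_ind2: _ => // *; apply: eqXM. Qed.

Lemma fps_of_poly_is_zmod_morphism : zmod_morphism (@fps_of_poly R).
Proof. by move=> p q; apply: funext => n; rewrite /fps_of_poly coefB. Qed.
Lemma fps_of_poly_is_monoid_morphism : monoid_morphism (@fps_of_poly R).
Proof.
split=> [|p q]; last by rewrite -fps_mul_poly.
by apply: funext => n; rewrite /fps_of_poly coef1.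
Qed.
HB.instance Definition _ := GRing.isZmodMorphism.Build {poly R} (fps R)
  (@fps_of_poly R) fps_of_poly_is_zmod_morphism.
HB.instance Definition _ := GRing.isMonoidMorphism.Build {poly R} (fps R)
  (@fps_of_poly R) fps_of_poly_is_monoid_morphism.

Definition cst (c : R) : fps R := fps_of_poly c%:P.
Definition qv : fps R := fps_of_poly 'X.

Lemma qvX k n : (qv ^+ k) n = (n == k)%:R.
Proof. by rewrite /qv -rmorphXn /= /fps_of_poly coefXn. Qed.

Lemma qvX_eq0 N k : (N <= k)%N -> qv ^+ k =[N] 0.
Proof. by move=> Nk n nN; rewrite qvX fps_coef0; case: eqP => // nk; lia. Qed.

Lemma qvXM_eq0 N k f : (N <= k)%N -> f * qv ^+ k =[N] 0.
Proof. by move=> Nk; rewrite -(mulr0 f); apply: eqXM => //; apply: qvX_eq0. Qed.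

Lemma cstM c f n : (cst c * f) n = c * f n.
Proof.
rewrite fps_coefM big_ord_recl /cst /fps_of_poly coefC eqxx subn0 big1 ?addr0 //.
by move=> i _; rewrite coefC mul0r.
Qed.

Lemma fps_coef_sum I (r : seq I) (P : pred I) (F : I -> fps R) n :
  (\sum_(i <- r | P i) F i) n = \sum_(i <- r | P i) F i n.
Proof. by elim/big_rec2: _ => // i y x _ <-. Qed.

Lemma eqX_expr0 f k : f 0%N = 0 -> f ^+ k =[k] 0.
Proof.
move=> f0; elim: k => [|k IH] n nk //.
rewrite exprS fps_coefM big_ord_recl f0 mul0r add0r.
by apply: big1 => j _; rewrite IH ?mulr0 // lift0; have := ltn_ord j; lia.
Qed.

(** Same shape as [sInv], so that [sInv] can be identified with the ring inverse. *)
Definition geom f : fps R := fun n => \sum_(k < n.+1) ((1 - f) ^+ k) n.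

Lemma geomV f : f 0%N = 1 -> geom f * f = 1.
Proof.
move=> f1; have u0 : (1 - f) 0%N = 0 by rewrite fps_coefD fps_coefN f1 subrr.
apply: eqXP => N; have gN : geom f =[N] \sum_(k < N) (1 - f) ^+ k.
  move=> n nN; rewrite fps_coef_sum /geom.
  have -> : N = (n.+1 + (N - n.+1))%N by lia.
  rewrite big_split_ord /= [X in _ = _ + X]big1 ?addr0 // => i _.
  by rewrite (eqX_expr0 u0) //; lia.
apply: eqX_trans (eqXM gN (@eqX_refl _ N f)) _.
have -> : (\sum_(k < N) (1 - f) ^+ k) * f = 1 - (1 - f) ^+ N.
  rewrite -[RHS]opprB subrX1 -mulNr mulrC; congr (_ * _); ring.
move=> n nN; rewrite fps_coefD fps_coefN (eqX_expr0 u0) //.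
by rewrite fps_coef0 subr0.
Qed.

Lemma fps_unit1 f : f 0%N = 1 -> f \is a GRing.unit.
Proof. by move=> f1; apply/asboolP; exists (geom f); apply: geomV. Qed.

Lemma geomE f : f 0%N = 1 -> geom f = f^-1.
Proof.
move=> f1; rewrite -[RHS]mul1r -(geomV f1) -mulrA mulrV ?mulr1 //.
exact: fps_unit1.
Qed.

Lemma eqX_mulI N f g h : f 0%N = 1 -> f * g =[N] f * h -> g =[N] h.
Proof.
move=> f1 E; have V := geomV f1.
have := eqXM (@eqX_refl _ N (geom f)) E.
by rewrite !mulrA V !mul1r.
Qed.

(** The substitution of [z q] for [q], used with [z = -1] for parity and with cube roots of unity
    for norms. *)
Definition rescale (z : R) f : fps R := fun n => z ^+ n * f n.

Lemma rescale_is_zmod_morphism z : zmod_morphism (rescale z).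
Proof. by move=> f g; apply: funext => n; rewrite /rescale mulrBr. Qed.
Lemma rescale_is_monoid_morphism z : monoid_morphism (rescale z).
Proof.
split=> [|f g]; apply: funext => n; rewrite /rescale.
  by rewrite fps_coef1; case: n => [|n]; rewrite ?mulr1 // mulr0.
rewrite !fps_coefM mulr_sumr; apply: eq_bigr => k _.
by rewrite mulrACA -exprD subnKC // -ltnS.
Qed.
HB.instance Definition _ z := GRing.isZmodMorphism.Build (fps R) (fps R)
  (rescale z) (rescale_is_zmod_morphism z).
HB.instance Definition _ z := GRing.isMonoidMorphism.Build (fps R) (fps R)
  (rescale z) (rescale_is_monoid_morphism z).

(* [dil k] substitutes [q^(k+1)] for [q]; the shift makes it injective for every
   [k]. *)
Definition dil (k : nat) f : fps R :=
  fun n => if (k.+1 %| n)%N then f (n %/ k.+1)%N else 0.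

Lemma eqX_dil k N f g : f =[N] g -> dil k f =[N] dil k g.
Proof.
move=> E n nN; rewrite /dil; case: ifP => // _; apply: E.
by apply: leq_ltn_trans nN; rewrite leq_div.
Qed.

Lemma dil_poly k p : dil k (fps_of_poly p) = fps_of_poly (p \Po 'X^(k.+1)).
Proof.
by apply: funext => n; rewrite /fps_of_poly coef_comp_poly_Xn.
Qed.

Lemma dil_is_zmod_morphism k : zmod_morphism (dil k).
Proof.
move=> f g; apply: funext => n; rewrite fps_coefD fps_coefN /dil.
by case: ifP => //; rewrite subr0.
Qed.
Lemma dil_is_monoid_morphism k : monoid_morphism (dil k).
Proof.
split=> [|f g].
  by rewrite -[1 in LHS](rmorph1 (@fps_of_poly R)) dil_poly comp_polyC rmorph1.
apply: eqXP => N; have [Ef Eg] := (eqX_trunc N f, eqX_trunc N g).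
apply: eqX_trans (eqX_dil k (eqXM Ef Eg)) _.
apply: eqX_trans (eqX_sym (eqXM (eqX_dil k Ef) (eqX_dil k Eg))).
by rewrite -rmorphM !dil_poly comp_polyM rmorphM.
Qed.
HB.instance Definition _ k := GRing.isZmodMorphism.Build (fps R) (fps R)
  (dil k) (dil_is_zmod_morphism k).
HB.instance Definition _ k := GRing.isMonoidMorphism.Build (fps R) (fps R)
  (dil k) (dil_is_monoid_morphism k).

Lemma dil_inj k : injective (dil k).
Proof.
move=> f g E; apply: funext => n.
have := congr1 (fun h : fps R => h (n * k.+1)%N) E.
by rewrite /dil dvdn_mull // mulnK.
Qed.

Lemma dil_qv k : dil k qv = qv ^+ k.+1.
Proof. by rewrite /qv dil_poly comp_polyX rmorphXn. Qed.
Lemma dil_cst k c : dil k (cst c) = cst c.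
Proof. by rewrite /cst dil_poly comp_polyC. Qed.
Lemma rescale_qv z : rescale z qv = cst z * qv.
Proof.
apply: funext => n; rewrite cstM /rescale -[qv]expr1 qvX.
by case: eqP => [->|]; rewrite ?expr1 // !mulr0.
Qed.
Lemma rescale_cst z c : rescale z (cst c) = cst c.
Proof.
apply: funext => -[|n]; rewrite /rescale /cst /fps_of_poly coefC ?mul1r //.
by rewrite mulr0.
Qed.
End FpsTheory.

(** * Infinite products *)

Lemma big_ord_block (T : Type) (idx : T) (op : Monoid.law idx) (k n : nat)
    (F : nat -> T) :
  \big[op/idx]_(i < n * k) F i =
  \big[op/idx]_(i < n) \big[op/idx]_(j < k) F (i * k + j)%N.
Proof.
elim: n => [|n IH]; first by rewrite !big_ord0.
by rewrite mulSnr big_split_ord big_ord_recr /= IH.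
Qed.

Lemma cube_root_expr3 (R : comNzRingType) (w : R) :
  w ^+ 2 + w + 1 = 0 -> w ^+ 3 = 1.
Proof.
move=> w0; apply/eqP; rewrite -subr_eq0.
have -> : w ^+ 3 - 1 = (w - 1) * (w ^+ 2 + w + 1) by ring.
by rewrite w0 mulr0.
Qed.

Section InfiniteProducts.
Variable R : comNzRingType.
Implicit Types (f g : fps R) (s z : R).

Definition fac s (e : nat) : fps R := 1 + cst s * qv R ^+ e.

Lemma cst_is_zmod_morphism : zmod_morphism (@cst R).
Proof. by move=> x y; rewrite /cst polyCB rmorphB. Qed.
Lemma cst_is_monoid_morphism : monoid_morphism (@cst R).
Proof. by split=> [|x y]; rewrite /cst ?polyCM ?rmorphM ?rmorph1. Qed.
HB.instance Definition _ := GRing.isZmodMorphism.Build R (fps R)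
  (@cst R) cst_is_zmod_morphism.
HB.instance Definition _ := GRing.isMonoidMorphism.Build R (fps R)
  (@cst R) cst_is_monoid_morphism.

Lemma cst_cube_root (w : R) : w ^+ 2 + w + 1 = 0 -> cst w ^+ 2 + cst w + 1 = 0.
Proof.
move=> w0; rewrite -rmorphXn -rmorphD -(rmorph1 (@cst R)) -rmorphD w0.
exact: rmorph0.
Qed.

Lemma fac_eq1 N s e : (N <= e)%N -> fac s e =[N] 1.
Proof.
move=> Ne; rewrite -[X in _ =[_] X]addr0; apply: eqXD => //.
exact: qvXM_eq0.
Qed.

(** The product of [1 + s q^(c m + r)] over all [m >= 0]. For positive [c] and [r] the factors with
    [m > n] do not reach the coefficient of [q^n]. *)
Definition iprod s (c r : nat) : fps R :=
  fun n => (\prod_(m < n.+1) fac s (c * m + r)) n.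

Lemma prod_fac_stable s c r N n1 n2 : (0 < c)%N -> (0 < r)%N ->
  (N <= n1)%N -> (n1 <= n2)%N ->
  \prod_(m < n2) fac s (c * m + r) =[N] \prod_(m < n1) fac s (c * m + r).
Proof.
move=> c0 r0 Nn n12; rewrite -(subnKC n12) big_split_ord /=.
rewrite -[X in _ =[_] X]mulr1; apply: eqXM => //.
apply: eqX_trans (@eqX_prod _ _ _ _ _ _ (fun=> 1) _) _ => [i _|].
  by apply: fac_eq1; nia.
by rewrite big1.
Qed.

Lemma iprodE s c r N n : (0 < c)%N -> (0 < r)%N -> (N <= n)%N ->
  iprod s c r =[N] \prod_(m < n) fac s (c * m + r).
Proof.
move=> c0 r0 Nn j jN; rewrite /iprod.
by rewrite -(@prod_fac_stable s c r j.+1 j.+1 n) //; apply: leq_trans jN Nn.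
Qed.

Lemma iprod0 s c r : (0 < c)%N -> (0 < r)%N -> iprod s c r 0%N = 1.
Proof.
move=> c0 r0; rewrite /iprod big_ord1 muln0 add0n.
by rewrite (@fac_eq1 1).
Qed.

Lemma iprod_split k s c r : (0 < k)%N -> (0 < c)%N -> (0 < r)%N ->
  iprod s c r = \prod_(j < k) iprod s (c * k) (c * j + r).
Proof.
move=> k0 c0 r0; apply: eqXP => N.
apply: eqX_trans (@iprodE s c r N (N * k) c0 r0 _) _; first by nia.
rewrite (@big_ord_block _ _ _ k N (fun m => fac s (c * m + r))) exchange_big /=.
apply: eqX_prod => j _.
apply: eqX_trans (eqX_sym (@iprodE _ _ _ N N _ _ _)); try nia.
rewrite (eq_bigr (fun i : 'I_N => fac s (c * k * i + (c * j + r)))) // => i _.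
by congr fac; nia.
Qed.


Lemma iprod_sq s c r : (0 < c)%N -> (0 < r)%N ->
  iprod s c r * iprod (- s) c r = iprod (- s ^+ 2) (2 * c) (2 * r).
Proof.
move=> c0 r0; apply: eqXP => N.
apply: eqX_trans (eqXM (@iprodE _ _ _ _ N _ _ _) (@iprodE _ _ _ _ N _ _ _)) _ => //.
apply: eqX_trans (eqX_sym (@iprodE _ _ _ N N _ _ _)); try nia.
rewrite -big_split /= (eq_bigr (fun m : 'I_N => fac (- s ^+ 2) (2 * c * m + 2 * r))) //.
move=> m _; have -> : (2 * c * m + 2 * r = (c * m + r) * 2)%N by nia.
by rewrite /fac exprM !(rmorphN (@cst R)) (rmorphXn (@cst R)) /=; ring.
Qed.

(** Factor by factor, [(1 + y)(1 + w y)(1 + w^2 y) = 1 + y^3]. *)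
Lemma iprod_cube w s c r : w ^+ 2 + w + 1 = 0 -> (0 < c)%N -> (0 < r)%N ->
  iprod s c r * iprod (s * w) c r * iprod (s * w ^+ 2) c r =
  iprod (s ^+ 3) (3 * c) (3 * r).
Proof.
move=> w3 c0 r0; apply: eqXP => N.
apply: eqX_trans (eqXM (eqXM (@iprodE _ _ _ _ N _ _ _)
  (@iprodE _ _ _ _ N _ _ _)) (@iprodE _ _ _ _ N _ _ _)) _ => //.
apply: eqX_trans (eqX_sym (@iprodE _ _ _ N N _ _ _)); try nia.
rewrite -!big_split /= (eq_bigr (fun m : 'I_N => fac (s ^+ 3) (3 * c * m + 3 * r))) //.
move=> m _; have -> : (3 * c * m + 3 * r = (c * m + r) * 3)%N by nia.
rewrite /fac exprM !(rmorphM (@cst R) s) !(rmorphXn (@cst R)) /=.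
have := cst_cube_root w3.
move: (cst w) (cst s) (qv R ^+ _) => x y u x3.
have -> : x ^+ 2 = - x - 1 by rewrite -[RHS]add0r -x3; ring.
rewrite [LHS](_ : _ = 1 - (y * u) ^+ 2 * (x ^+ 2 + x + 1)
  - (y * u) ^+ 3 * (x ^+ 2 + x)); last by ring.
by rewrite x3 (_ : x ^+ 2 + x = -1); [ring | rewrite -[RHS]add0r -x3; ring].
Qed.

Lemma rescale_iprod z s c r : z ^+ c = 1 -> (0 < c)%N -> (0 < r)%N ->
  rescale z (iprod s c r) = iprod (s * z ^+ r) c r.
Proof.
move=> zc c0 r0; apply: eqXP => N n nN.
rewrite [LHS](_ : _ = rescale z (\prod_(m < N) fac s (c * m + r)) n); last first.
  by rewrite /rescale (@iprodE _ _ _ N N).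
rewrite (@iprodE _ _ _ N N) // rmorph_prod /=.
congr (_ n); apply: eq_bigr => m _; rewrite /fac rmorphD rmorph1 rmorphM rmorphXn /=.
rewrite rescale_qv rescale_cst exprMn -rmorphXn /= exprD exprM zc expr1n mul1r.
by rewrite rmorphM /= mulrA.
Qed.

Lemma dil_iprod k s c r : (0 < c)%N -> (0 < r)%N ->
  dil k (iprod s c r) = iprod s (k.+1 * c) (k.+1 * r).
Proof.
move=> c0 r0; apply: eqXP => N.
apply: eqX_trans (eqX_dil k (@iprodE _ _ _ _ N _ _ _)) _ => //.
apply: eqX_trans (eqX_sym (@iprodE _ _ _ N N _ _ _)); try nia.
rewrite rmorph_prod /= (eq_bigr (fun m : 'I_N => fac s (k.+1 * c * m + k.+1 * r))) //.
move=> m _; rewrite /fac rmorphD rmorph1 rmorphM rmorphXn /= dil_qv dil_cst.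
by rewrite -exprM; congr (1 + _ * _ ^+ _); nia.
Qed.

(* [E(q^c)] *)
Definition eul c := iprod (-1) c c.

Lemma eul0 c : (0 < c)%N -> eul c 0%N = 1.
Proof. by move=> c0; apply: iprod0. Qed.
Lemma dil_eul k c : (0 < c)%N -> dil k (eul c) = eul (k.+1 * c).
Proof. by move=> c0; apply: dil_iprod. Qed.

(* Norm of [eul c] for the substitutions [q -> w^i q] with [w^3 = 1]. *)
Lemma norm_eul w c : w ^+ 2 + w + 1 = 0 -> coprime 3 c -> (0 < c)%N ->
  eul c * rescale w (eul c) * rescale (w ^+ 2) (eul c) * eul (9 * c) =
  eul (3 * c) ^+ 4.
Proof.
move=> w0 c3 c0.
have w3 := cube_root_expr3 w0.
have wc r (i : nat) : (w ^+ i) ^+ (c * 3 * r) = 1.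
  rewrite -exprM (_ : (i * (c * 3 * r) = 3 * (i * c * r))%N); last by lia.
  by rewrite exprM w3 expr1n.
have wc3 i : (w ^+ i) ^+ (c * 3) = 1 by rewrite -(wc 1%N i) muln1.
(* The factors are sorted by exponent [c (3 m + r + 1)]. For [r < 2] the exponent is prime to 3, so
   its power of [w] is again a primitive cube root [v], and [iprod_cube] applies; the class [r = 2]
   is [eul (3 c)], fixed by each rescaling. *)
have key r : (r < 2)%N ->
    let f := iprod (-1) (c * 3) (c * r + c) in
    f * rescale w f * rescale (w ^+ 2) f = iprod (-1) (3 * (c * 3)) (3 * (c * r + c)).
  move=> r2 /=; have p1 : (0 < c * 3)%N by lia.
  have p2 : (0 < c * r + c)%N by lia.
  rewrite -{1}[w]expr1 !rescale_iprod // expr1.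
  rewrite -[in RHS](_ : (-1) ^+ 3 = -1 :> R); last by ring.
  have [v [v0 v1 v2]] : exists v, [/\ v ^+ 2 + v + 1 = 0, w ^+ (c * r + c) = v &
      (w ^+ 2) ^+ (c * r + c) = v ^+ 2].
    exists (w ^+ (c * r + c)); split=> //; last by rewrite -!exprM mulnC.
    have : ((c * r + c) %% 3 != 0)%N.
      have -> : (c * r + c = r.+1 * c)%N by lia.
      rewrite -[(_ == _)%N]/(3 %| r.+1 * c)%N Gauss_dvdl //.
      by case: r r2 {p2} => [|[]].
    rewrite -(expr_mod _ w3).
    have : ((c * r + c) %% 3 < 3)%N by rewrite ltn_mod.
    case: (_ %% 3)%N => [|[|[]]] // _ _; rewrite ?expr1 //.
    by rewrite -exprM -[(2 * 2)%N]/(3 + 1)%N exprD w3 -w0; ring.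
  by rewrite v1 v2 iprod_cube.
rewrite {1 2 3}/eul (@iprod_split 3 (-1) c c) // !big_ord_recl big_ord0 /= mulr1.
have := key 0%N isT; have := key 1%N isT => /= k1 k0.
rewrite /bump !rmorphM /=.
have fix3 i : rescale (w ^+ i) (iprod (-1) (c * 3) (c * 2 + c)) = eul (3 * c).
  rewrite rescale_iprod; try lia; last exact: wc3.
  rewrite (_ : (c * 2 + c = c * 3)%N) ?wc3 ?mulr1 /eul; last by lia.
  by rewrite mulnC.
have f2 := fix3 2%N; have := fix3 1%N; rewrite expr1 => f1.
have := fix3 0%N; rewrite expr0 => f0.
have {}f0 : iprod (-1) (c * 3) (c * 2 + c) = eul (3 * c).
  by rewrite /eul mulnC; congr iprod; lia.
rewrite /= in f1 f2 *; rewrite [(1 + 0)%N]/= [(1 + (1 + 0))%N]/= f1 f2 f0.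
(* The two norms from [key] contain all factors of [eul (3 c)] except those of [eul (9 c)]. *)
have -> : eul (3 * c) = iprod (-1) (3 * (c * 3)) (3 * (c * 0 + c)) *
    iprod (-1) (3 * (c * 3)) (3 * (c * 1 + c)) * eul (9 * c).
  rewrite /eul (@iprod_split 3 (-1) (3 * c) (3 * c)) //; try lia.
  rewrite !big_ord_recl big_ord0 /= mulr1 mulrA.
  by congr (iprod _ _ _ * iprod _ _ _ * iprod _ _ _); rewrite /bump /=; lia.
rewrite -k0 -k1; ring.
Qed.
End InfiniteProducts.

(** * The Jacobi triple product *)

Section GaussBinomial.
Variables (A : comNzRingType) (Q : A).

(** The Gaussian binomial, given by the q-Pascal rule so as to avoid division in [A]. *)
Fixpoint gbin n k : A :=
  match n, k with
  | _, 0 => 1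
  | 0, _.+1 => 0
  | n'.+1, k'.+1 => gbin n' k' + Q ^+ k * gbin n' k
  end.

Lemma gbin_n0 n : gbin n 0 = 1. Proof. by case: n. Qed.

Lemma gbin_small n k : (n < k)%N -> gbin n k = 0.
Proof.
elim: n k => [|n IH] [|k] //= nk.
by rewrite !IH ?mulr0 ?addr0 //; lia.
Qed.

Definition qfact n := \prod_(j < n) (1 - Q ^+ j.+1).

Lemma qfactS n : qfact n.+1 = qfact n * (1 - Q ^+ n.+1).
Proof. by rewrite /qfact big_ord_recr. Qed.

(** The factorial formula with cleared denominators; it yields the limit in [eul_gbin]. *)
Lemma gbin_fact n k : (k <= n)%N ->
  gbin n k * qfact k * qfact (n - k) = qfact n.
Proof.
elim: n k => [|n IH] [|k] //= kn.
- by rewrite /qfact !big_ord0 !mulr1.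
- by rewrite subn0 /qfact big_ord0 !mul1r.
rewrite subSS mulrDl mulrDl.
have -> : gbin n k * qfact k.+1 * qfact (n - k) = qfact n * (1 - Q ^+ k.+1).
  by rewrite -(IH k) // qfactS; ring.
rewrite leq_eqVlt in kn; case/orP: kn => [/eqP [->]|kn].
  by rewrite gbin_small // mulr0 !mul0r addr0 qfactS.
have := IH k.+1 kn; have -> : (n - k = (n - k.+1).+1)%N by lia.
rewrite !qfactS => E.
have -> : Q ^+ k.+1 * gbin n k.+1 * (qfact k * (1 - Q ^+ k.+1)) *
  (qfact (n - k.+1) * (1 - Q ^+ (n - k.+1).+1)) =
  qfact n * (Q ^+ k.+1 - Q ^+ k.+1 * Q ^+ (n - k.+1).+1) by rewrite -E; ring.
rewrite -exprD; have -> : (k.+1 + (n - k.+1).+1 = n.+1)%N by lia.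
ring.
Qed.

(** Once the factor [j = 0] is split off, the rest is the same product at [z Q]; the q-Pascal rule
    then matches the terms. *)
Lemma gauss_binomial n (y z : A) :
  \prod_(j < n) (y + z * Q ^+ j) =
  \sum_(k < n.+1) gbin n k * Q ^+ 'C(k, 2) * z ^+ k * y ^+ (n - k).
Proof.
elim: n z => [|n IH] z.
  by rewrite big_ord0 big_ord1 /= !mulr1.
rewrite big_ord_recl expr0 mulr1 (eq_bigr (fun j : 'I_n => y + (z * Q) * Q ^+ j)).
  2: by move=> j _; rewrite lift0 exprS mulrA.
rewrite IH mulrDl [RHS]big_ord_recl gbin_n0 !expr0 !mulr1 !mul1r subn0.
pose F k := gbin n k * Q ^+ 'C(k, 2) * (z * Q) ^+ k * y ^+ (n - k).
pose G k := Q ^+ k.+1 * gbin n k.+1 * Q ^+ 'C(k.+1, 2) * z ^+ k.+1 * y ^+ (n - k).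
have E k : gbin n.+1 k.+1 * Q ^+ 'C(k.+1, 2) * z ^+ k.+1 * y ^+ (n.+1 - k.+1) =
    z * F k + G k.
  rewrite /F /G subSS /= binS bin1 exprD exprMn !exprS; ring.
rewrite [X in _ = _ + X](eq_bigr (fun k : 'I_n.+1 => z * F k + G k)); last first.
  by move=> k _; rewrite -E.
rewrite big_split /= [RHS]addrCA [LHS]addrC; congr (_ + _); first by rewrite mulr_sumr.
rewrite big_ord_recl [in RHS]big_ord_recr subn0 gbin_n0 !expr0 !mulr1 !mul1r.
rewrite mulrDr mulr_sumr.
rewrite [G _](_ : _ = 0); last by rewrite /G gbin_small // mulr0 !mul0r.
rewrite [X in _ = _ + X]addr0 -exprS; congr (_ + _).
apply: eq_bigr => k _; rewrite /G lift0 [nat_of_ord (widen_ord _ _)]/=.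
have -> : (n - k = (n - k.+1).+1)%N by have := ltn_ord k; lia.
rewrite exprMn !exprS; ring.
Qed.
End GaussBinomial.
Arguments gbin {A} Q n k : simpl never.

Lemma sum_double_ord n : (\sum_(i < n) 2 * i = n * n.-1)%N.
Proof.
elim: n => [|n IH]; first by rewrite big_ord0.
by rewrite big_ord_recr /= IH; case: n {IH} => //= n; lia.
Qed.

Lemma bin2_double k : ('C(k, 2) * 2 = k * k.-1)%N.
Proof.
elim: k => [|k IH] //; rewrite binS bin1 mulnDl IH; case: k {IH} => //= k; lia.
Qed.

Section TripleProduct.
Variable R : comNzRingType.
Implicit Types (f g : fps R) (s z : R).

(** The sum over [-n <= l <= n], indexed by [k = l + n]. *)
Definition bsum (n : nat) (F : int -> fps R) :=
  \sum_(k < n.*2.+1) F (k%:Z - n%:Z).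

(* The theta function of parameters [s = 1] or [-1], [h], [b] is
   [sum_l s^l q^(h l (l - 1) + b l)]: [psi(q^2)] is [1, 4, 2], [phi(-q)] is
   [-1, 1, 1]. The exponent is nonnegative for [0 <= b <= 2 h]. *)
Definition thexp (h b : nat) (l : int) : nat :=
  absz (h%:Z * l * (l - 1) + b%:Z * l).

Definition thterm s h b l : fps R := cst (s ^+ `|l|%N) * qv R ^+ thexp h b l.

Lemma thexpE h b l : (b <= 2 * h)%N ->
  (thexp h b l)%:Z = h%:Z * l * (l - 1) + b%:Z * l.
Proof.
move=> bh; rewrite /thexp abszE ger0_norm //.
case: l => [[|m]|m]; [lia| nia | rewrite NegzE; nia].
Qed.

Lemma thexp_ge N h b l : (0 < h)%N -> (b <= 2 * h)%N -> (N < `|l|)%N ->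
  (N <= thexp h b l)%N.
Proof.
move=> h0 bh Nl; rewrite -lez_nat (thexpE l bh).
case: l Nl => [m|m]; last rewrite NegzE; move=> /= Nm.
  have e1 : N%:Z <= m%:Z * (m%:Z - 1) by nia.
  have e2 : m%:Z * (m%:Z - 1) <= h%:Z * (m%:Z * (m%:Z - 1)) by nia.
  nia.
have e1 : N%:Z <= m.+1%:Z by lia.
have -> : h%:Z * - m.+1%:Z * (- m.+1%:Z - 1) + b%:Z * - m.+1%:Z =
  m.+1%:Z * (h%:Z * m%:Z + (2 * h%:Z - b%:Z)) by rewrite -addn1 PoszD; ring.
case: m Nm e1 => [|m] Nm e1; first by nia.
have e2 : 1 <= h%:Z * m.+1%:Z + (2 * h%:Z - b%:Z) by nia.
nia.
Qed.

Lemma qvXI k f g : qv R ^+ k * f = qv R ^+ k * g -> f = g.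
Proof.
have E h n : (qv R ^+ k * h) (n + k)%N = h n.
  rewrite mulrC fps_coefM (bigD1 (Ordinal (leq_addr k n : (n < (n + k).+1)%N))) //=.
  rewrite addKn qvX eqxx mulr1 big1 ?addr0 // => i ni.
  rewrite qvX; case: eqP => [e|_]; last by rewrite mulr0.
  case/eqP: ni; apply: val_inj => /=; have := ltn_ord i; lia.
by move=> fg; apply: funext => n; rewrite -E fg E.
Qed.

(** The q-binomial theorem with [2 n] factors, [Q = q^(2 h)], [y = q^(2 h n - b)] and [z = s]. The
    first [n] factors, in reverse order, give one product and the last [n] the other, up to a power
    of [q] and a sign [s^n], which are cancelled. *)
Lemma finite_triple_product s h b n : s * s = 1 -> (0 < b)%N -> (b <= 2 * h)%N ->
  (\prod_(m < n) fac s (2 * h * m + (2 * h - b))) *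
  (\prod_(m < n) fac s (2 * h * m + b)) =
  bsum n (fun l => gbin (qv R ^+ (2 * h)) n.*2 (absz (n%:Z + l)) * thterm s h b l).
Proof.
move=> ss b0 bh; case: n => [|n'].
  rewrite !big_ord0 /bsum big_ord1 /= /thterm /thexp /= !mulr0 !mulr1 !expr0.
  by rewrite rmorph1 !mulr1.
set n := n'.+1; set M := (2 * h * n - b)%N.
have sk k : cst s ^+ k * cst s ^+ k = 1 by rewrite -exprMn -rmorphM ss rmorph1 expr1n.
have := gauss_binomial (qv R ^+ (2 * h)) n.*2 (qv R ^+ M) (cst s).
rewrite -addnn big_split_ord /=.
have -> : \prod_(i < n) (qv R ^+ M + cst s * qv R ^+ (2 * h) ^+ i) =
   qv R ^+ (h * (n * n.-1)) * cst s ^+ n *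
   \prod_(m < n) fac s (2 * h * m + (2 * h - b)).
  rewrite [X in _ = _ * X](reindex_inj rev_ord_inj) /=.
  rewrite -sum_double_ord.
  rewrite big_distrr /= expr_sum.
  have -> : cst s ^+ n = \prod_(i < n) cst s by rewrite prodr_const card_ord.
  rewrite -!big_split /=; apply: eq_bigr => i _.
  have -> : M = (h * (2 * i) + (2 * h * (n - i.+1) + (2 * h - b)))%N.
    by rewrite /M; have := ltn_ord i; nia.
  rewrite /fac -exprM exprD (_ : (2 * h * i = h * (2 * i))%N); last by nia.
  have := sk 1%N; rewrite expr1; move: (qv R ^+ _) (qv R ^+ _) (cst s) => x y z zz.
  rewrite [RHS](_ : _ = y * x * (z * z) + z * y); last by ring.
  by rewrite zz mulr1.
have -> : \prod_(i < n) (qv R ^+ M + cst s * qv R ^+ (2 * h) ^+ (n + i)) =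
   qv R ^+ (M * n) * \prod_(m < n) fac s (2 * h * m + b).
  have -> : qv R ^+ (M * n) = \prod_(i < n) qv R ^+ M.
    by rewrite prodr_const card_ord exprM.
  rewrite -big_split /=; apply: eq_bigr => i _.
  rewrite /fac -exprM (_ : (2 * h * (n + i) = M + (2 * h * i + b))%N).
    2: by rewrite /M; nia.
  by rewrite exprD; ring.
move=> E; apply: (@qvXI (h * (n * n.-1) + M * n)).
have -> x y : qv R ^+ (h * (n * n.-1) + M * n) * (x * y) =
  cst s ^+ n * ((qv R ^+ (h * (n * n.-1)) * cst s ^+ n * x) * (qv R ^+ (M * n) * y)).
  by rewrite exprD -[LHS]mul1r -(sk n); ring.
rewrite E /bsum -addnn !mulr_sumr; apply: eq_bigr => k _.
have -> : n%:Z + (k%:Z - n%:Z) = k by lia.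
rewrite absz_nat /thterm.
have kn : (k <= n + n)%N by rewrite -ltnS.
have -> : cst (s ^+ absz (k%:Z - n%:Z)) = cst s ^+ n * cst s ^+ k.
  rewrite rmorphXn -exprD; have [nk|kn'] := leqP n k.
    have -> : (n + k = n + n + absz (k%:Z - n%:Z))%N by lia.
    by rewrite exprD exprD sk mul1r.
  have -> : (n + k = k + k + absz (k%:Z - n%:Z))%N by lia.
  by rewrite exprD exprD sk mul1r.
(* Recentring the index at [l = k - n] turns the quadratic exponent into [thexp]. *)
have E2 : (2 * h * 'C(k, 2) + M * (n + n - k) =
    h * (n * n.-1) + M * n + thexp h b (k%:Z - n%:Z))%N.
  apply/eqP; rewrite -eqz_nat !PoszD !PoszM (thexpE _ bh) /M.
  rewrite -!subzn //; last by rewrite /n; nia.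
  have e' : 'C(k, 2)%:Z * 2 = k%:Z * (k%:Z - 1).
    have := bin2_double k; case: (k : nat) => [|j] /=; lia.
  rewrite !PoszM PoszD; apply/eqP.
  have -> : n.-1%:Z = n%:Z - 1 by rewrite /n /=; lia.
  have -> : (2%N : int) * h * 'C(k, 2) = h%:Z * ('C(k, 2)%:Z * 2) by lia.
  rewrite e'; lia.
have E3 : qv R ^+ (2 * h) ^+ 'C(k, 2) * qv R ^+ M ^+ (n + n - k) =
   qv R ^+ (h * (n * n.-1) + M * n) * qv R ^+ thexp h b (k%:Z - n%:Z).
  by rewrite -!exprM -!exprD E2.
rewrite [LHS](_ : _ = gbin (qv R ^+ (2 * h)) (n + n) k * (cst s ^+ n * cst s ^+ k) *
   (qv R ^+ (2 * h) ^+ 'C(k, 2) * qv R ^+ M ^+ (n + n - k))); last by ring.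
by rewrite E3; ring.
Qed.
End TripleProduct.

(** * The cubic relations of level 6 *)

Lemma big_ord_triple (V : nmodType) n (F : nat -> V) :
  \sum_(i < n * 3) F i = \sum_(j < n) (F (j * 3)%N + F (j * 3 + 1)%N + F (j * 3 + 2)%N).
Proof.
rewrite big_ord_block; apply: eq_bigr => j _.
by rewrite !big_ord_recl big_ord0 /= addn0 addr0 addrA.
Qed.

(** * Theta functions and their 3-dissections *)

Section Theta.
Variable R : comNzRingType.
Implicit Types (f g : fps R) (s z : R).
Local Notation q := (qv R).

(** The product side of the triple product whose sum side has the terms [thterm s h b]. *)
Definition thprod s h b : fps R :=
  eul R (2 * h) * iprod s (2 * h) (2 * h - b) * iprod s (2 * h) b.

Lemma eul_qfact N m c : (0 < c)%N -> (N <= m)%N -> eul R c =[N] qfact (q ^+ c) m.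
Proof.
move=> c0 Nm; apply: eqX_trans (@iprodE _ _ _ _ N m _ _ _) _ => //.
rewrite /qfact (eq_bigr (fun j : 'I_m => 1 - q ^+ c ^+ j.+1)) // => j _.
by rewrite /fac rmorphN rmorph1 mulN1r -exprM mulnSr.
Qed.

(** In [gbin_fact] the three factorials all agree with [eul c] modulo [q^N], so the Gaussian
    binomial tends to the inverse of [eul c]. *)
Lemma eul_gbin N n k c : (0 < c)%N -> (N <= k)%N -> (N <= n - k)%N -> (k <= n)%N ->
  eul R c * gbin (q ^+ c) n k =[N] 1.
Proof.
move=> c0 Nk Nnk kn.
have E m (Nm : (N <= m)%N) := @eul_qfact N m c c0 Nm.
have {}kn := gbin_fact (q ^+ c) kn.
apply: (eqX_mulI (eul0 R c0)); rewrite mulr1.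
apply: eqX_trans (eqX_sym (E n _)); last by lia.
rewrite -kn [X in _ =[_] X](_ : _ = qfact (q ^+ c) k *
  (qfact (q ^+ c) (n - k) * gbin (q ^+ c) n k)); last by ring.
by apply: eqXM; [apply: E | apply: eqXM => //; apply: E].
Qed.

Lemma thterm_eq0 N s h b l : (0 < h)%N -> (b <= 2 * h)%N -> (N < absz l)%N ->
  thterm s h b l =[N] 0.
Proof. by move=> h0 bh Nl; apply: qvXM_eq0; apply: thexp_ge. Qed.

(** In the finite form, terms with [|l| > N] vanish modulo [q^N]. For the others [n > 2 N] keeps
    [n + l] and [n - l] above [N], so [eul_gbin] removes the Gaussian binomial. *)
Lemma triple_product N n s h b : s * s = 1 -> (0 < h)%N -> (0 < b)%N ->
  (b < 2 * h)%N -> (N.*2 < n)%N ->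
  thprod s h b =[N] bsum n (thterm s h b).
Proof.
move=> ss h0 b0 bh Nn.
have [h2 bh' hb0] : [/\ (0 < 2 * h)%N, (b <= 2 * h)%N & (0 < 2 * h - b)%N].
  by split; lia.
rewrite /thprod -mulrA.
apply: eqX_trans (eqXM (@eqX_refl _ N _) (eqXM (@iprodE _ _ _ _ N n _ _ _)
  (@iprodE _ _ _ _ N n _ _ _))) _ => //; try lia.
rewrite finite_triple_product // /bsum mulr_sumr.
apply: eqX_sum => k _; set l := (_ - _); rewrite mulrA.
rewrite -[X in _ =[_] X]mul1r.
have [Nl|lN] := ltnP N (absz l).
  apply: eqX_trans (eqXM (@eqX_refl _ N _) (thterm_eq0 _ _ _ Nl)) _ => //.
  apply: eqX_sym.
  apply: eqX_trans (eqXM (@eqX_refl _ N _) (thterm_eq0 _ _ _ Nl)) _ => //.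
  by rewrite !mulr0.
apply: eqXM => //; have := ltn_ord k; rewrite /l in lN * => kn.
by apply: eul_gbin => //; lia.
Qed.

(** The bound [3 n + 1] makes each residue class modulo 3 a full range [-n <= l <= n]. *)
Lemma bsum_triple n (F : int -> fps R) :
  bsum (3 * n).+1 F =
  bsum n (fun l => F (3 * l)) + bsum n (fun l => F (3 * l + 1)) +
  bsum n (fun l => F (3 * l - 1)).
Proof.
rewrite /bsum (_ : (3 * n).+1.*2.+1 = n.*2.+1 * 3)%N; last by lia.
rewrite (big_ord_triple _ (fun k => F (k%:Z - (3 * n).+1%:Z))) -!big_split /=.
apply: eq_bigr => j _.
rewrite [RHS]addrC addrA; congr (F _ + F _ + F _); lia.
Qed.

(** The range has an odd number of terms; the lowest is left unpaired. *)
Lemma bsum_double n (F : int -> fps R) :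
  bsum n.*2.+1 F =
  F (- (n.*2.+1)%:Z) + (bsum n (fun l => F (2 * l)) + bsum n (fun l => F (2 * l + 1))).
Proof.
rewrite /bsum -[in LHS]addnn big_ord_recl /= sub0r; congr (_ + _).
rewrite addnn (_ : (n.*2.+1.*2 = n.*2.+1 * 2)%N); last by lia.
under eq_bigr => i _ do rewrite /bump leq0n add1n.
rewrite (@big_ord_block _ _ _ 2 n.*2.+1 (fun k => F (k.+1%:Z - n.*2.+1%:Z))).
rewrite -big_split /=.
apply: eq_bigr => j _; rewrite !big_ord_recl big_ord0 addr0 /=.
by congr (F _ + F _); rewrite ?/bump /=; lia.
Qed.

Lemma bsum_opp n (F : int -> fps R) : bsum n F = bsum n (fun l => F (- l)).
Proof.
rewrite /bsum (reindex_inj rev_ord_inj) /=; apply: eq_bigr => i _.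
congr F; have := ltn_ord i; lia.
Qed.

Lemma dil_thterm k s h b l :
  dil k (thterm s h b l) = thterm s (k.+1 * h) (k.+1 * b) l.
Proof.
rewrite /thterm rmorphM rmorphXn /= dil_cst dil_qv -exprM; congr (_ * _ ^+ _).
rewrite /thexp !PoszM -[X in (X * _)%N]absz_nat -abszM; congr absz; ring.
Qed.

Lemma dil_bsum k n s h b :
  dil k (bsum n (thterm s h b)) = bsum n (thterm s (k.+1 * h) (k.+1 * b)).
Proof. by rewrite /bsum rmorph_sum /=; apply: eq_bigr => i _; rewrite dil_thterm. Qed.

Lemma eq_bsum n (F G : int -> fps R) : F =1 G -> bsum n F = bsum n G.
Proof. by move=> E; apply: eq_bigr => i _; apply: E. Qed.

(* 3-dissection of [psi(q^2) = sum_l q^(4 l^2 - 2 l)]. *)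
Lemma psi_dissection :
  thprod 1 4 2 = dil 2 (thprod 1 3 2) + q ^+ 2 * dil 8 (thprod 1 4 2).
Proof.
apply: eqXP => N; have [[o1 o2] o3] := (mulr1 (1 : R), isT, isT).
pose n := N.*2.+1.
apply: eqX_trans (@triple_product N (3 * n).+1 1 4 2 _ _ _ _ _) _ => //; first by lia.
have A3 := eqX_dil 2 (@triple_product N n.*2.+1 1 3 2 o1 isT isT isT ltac:(lia)).
have A9 := eqX_dil 8 (@triple_product N n 1 4 2 o1 isT isT isT ltac:(lia)).
apply: eqX_trans (eqX_sym (eqXD A3 (eqXM (@eqX_refl _ N _) A9))).
rewrite !dil_bsum bsum_double bsum_triple.
have t s h b l : s = 1 -> thterm s h b l = q ^+ thexp h b l.
  by move=> ->; rewrite /thterm expr1n rmorph1 mul1r.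
(* The classes [3 l] and [3 l - 1] become the even and odd terms of the dilated [thprod 1 3 2]; the
   class [3 l + 1] is [q^2 psi(q^18)]. *)
have -> : bsum n (fun l => thterm (1 : R) 4 2 (3 * l)) =
          bsum n (fun l => thterm (1 : R) (3 * 3) (3 * 2) (2 * l)).
  by apply: eq_bsum => l; rewrite !t //; congr (_ ^+ _); congr absz; ring.
have -> : bsum n (fun l => thterm (1 : R) 4 2 (3 * l - 1)) =
          bsum n (fun l => thterm (1 : R) (3 * 3) (3 * 2) (2 * l + 1)).
  rewrite bsum_opp; apply: eq_bsum => l.
  by rewrite !t //; congr (_ ^+ _); congr absz; ring.
have -> : bsum n (fun l => thterm (1 : R) 4 2 (3 * l + 1)) =
          q ^+ 2 * bsum n (thterm (1 : R) (9 * 4) (9 * 2)).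
  rewrite [in RHS]bsum_opp /bsum mulr_sumr; apply: eq_bigr => i _.
  move: (i%:Z - n%:Z) => l; rewrite !t // -exprD; congr (_ ^+ _).
  apply/eqP; rewrite -eqz_nat PoszD !thexpE //; apply/eqP; ring.
(* The unpaired term from [bsum_double] is zero modulo [q^N]. *)
rewrite -[X in X =[N] _]add0r -addrA -[X in _ =[N] X]addrA; apply: eqXD.
  by apply: eqX_sym; apply: thterm_eq0 => //; lia.
by rewrite addrAC addrA.
Qed.

(* 3-dissection of [phi(-q) = sum_l (-1)^l q^(l^2)]. *)
Lemma phi_dissection :
  thprod (-1) 1 1 = dil 8 (thprod (-1) 1 1) - (q * dil 2 (thprod (-1) 3 1)) *+ 2.
Proof.
apply: eqXP => N; have o1 : -1 * -1 = 1 :> R by ring.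
pose n := N.*2.+1.
apply: eqX_trans (@triple_product N (3 * n).+1 (-1) 1 1 _ _ _ _ _) _ => //.
  by lia.
have A3 := eqX_dil 2 (@triple_product N n (-1) 3 1 o1 isT isT isT ltac:(lia)).
have A9 := eqX_dil 8 (@triple_product N n (-1) 1 1 o1 isT isT isT ltac:(lia)).
have B3 := eqXM (@eqX_refl _ N (- q *+ 2)) A3.
have -> f : dil 8 (thprod (-1) 1 1) - (q * f) *+ 2 =
    dil 8 (thprod (-1) 1 1) + - q *+ 2 * f.
  by rewrite mulrnAl mulNr mulNrn.
apply: eqX_trans (eqX_sym (eqXD A9 B3)).
rewrite !dil_bsum bsum_triple.
have sg l m : odd (absz l) = odd (absz m) ->
    cst ((-1) ^+ absz l) = cst ((-1) ^+ absz m) :> fps R.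
  by move=> e; rewrite -signr_odd e signr_odd.
have sgN l m : odd (absz l) = ~~ odd (absz m) ->
    cst ((-1) ^+ absz l) = - cst ((-1) ^+ absz m) :> fps R.
  move=> e; rewrite -signr_odd e -[in RHS]signr_odd -rmorphN.
  by case: odd => /=; rewrite ?expr0 ?expr1 ?opprK.
(* The class [3 l] is [phi(-q^9)]; the classes [3 l + 1] and [3 l - 1] correspond under [l -> -l]
   and contribute equally, whence the factor 2. *)
have -> : bsum n (fun l => thterm (-1 : R) 1 1 (3 * l)) =
          bsum n (thterm (-1 : R) (9 * 1) (9 * 1)).
  apply: eq_bsum => l; rewrite /thterm (sg _ l); last by lia.
  by congr (_ * _ ^+ _); congr absz; ring.
have -> : bsum n (fun l => thterm (-1 : R) 1 1 (3 * l + 1)) =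
          - q * bsum n (thterm (-1 : R) (3 * 3) (3 * 1)).
  rewrite [in RHS]bsum_opp /bsum mulr_sumr; apply: eq_bigr => i _.
  move: (i%:Z - n%:Z) => l; rewrite /thterm (sgN _ (- l)); last by lia.
  rewrite !mulNr mulrCA -exprS; congr (- (_ * _ ^+ _)).
  apply/eqP; rewrite -eqz_nat -[(thexp _ _ _).+1]addn1 PoszD !thexpE //; apply/eqP; ring.
have -> : bsum n (fun l => thterm (-1 : R) 1 1 (3 * l - 1)) =
          - q * bsum n (thterm (-1 : R) (3 * 3) (3 * 1)).
  rewrite /bsum mulr_sumr; apply: eq_bigr => i _.
  move: (i%:Z - n%:Z) => l; rewrite /thterm (sgN _ l); last by lia.
  rewrite !mulNr mulrCA -exprS; congr (- (_ * _ ^+ _)).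
  apply/eqP; rewrite -eqz_nat -[(thexp _ _ _).+1]addn1 PoszD !thexpE //; apply/eqP; ring.
by rewrite -addrA -mulrDl -mulr2n.
Qed.
End Theta.

(** * Eta quotients for the theta functions, and their norms *)

Section CubicIdentities.
Variable R : comNzRingType.
Implicit Types (f g : fps R) (s z : R).
Local Notation q := (qv R).
Local Notation e := (eul R).

Lemma iprod_split2 s c r : (0 < c)%N -> (0 < r)%N ->
  iprod s c r = iprod s (2 * c) r * iprod s (2 * c) (c + r).
Proof.
move=> c0 r0; rewrite (@iprod_split _ 2) // !big_ord_recl big_ord0 mulr1 /=.
by rewrite muln0 add0n muln1 mulnC.
Qed.

Lemma iprod_split3 s c r : (0 < c)%N -> (0 < r)%N ->
  iprod s c r =
  iprod s (3 * c) r * iprod s (3 * c) (c + r) * iprod s (3 * c) (2 * c + r).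
Proof.
move=> c0 r0; rewrite (@iprod_split _ 3) // !big_ord_recl big_ord0 mulr1 /= mulrA.
by rewrite muln0 add0n muln1 [(c * 3)%N]mulnC [(c * 2)%N]mulnC.
Qed.

Lemma iprod_eul c : (0 < c)%N -> iprod (1 : R) c c * e c = e (2 * c).
Proof. by move=> c0; rewrite iprod_sq // expr1n. Qed.

(** Here and in the next three lemmas the factors are split by residue class, and for [s = 1] also
    paired as [(1 + u)(1 - u)], to turn a theta product into an eta quotient with cleared
    denominators. *)
Lemma psi_eul : thprod (1 : R) 4 2 * e 2 = e 4 ^+ 2.
Proof.
have E2 : e 2 = iprod (-1 : R) 4 2 * e 4 := @iprod_split2 (-1) 2 2 isT isT.
have E4 : e 4 = iprod (-1 : R) 8 4 * e 8 := @iprod_split2 (-1) 4 4 isT isT.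
have I4 : iprod (1 : R) 4 2 = iprod (1 : R) 8 2 * iprod (1 : R) 8 6 :=
  @iprod_split2 1 4 2 isT isT.
have S4 : iprod (1 : R) 4 2 * iprod (-1 : R) 4 2 = iprod (-1 : R) 8 4.
  by rewrite iprod_sq // expr1n.
have T : thprod (1 : R) 4 2 = e 8 * iprod (1 : R) 8 6 * iprod (1 : R) 8 2 by [].
by rewrite T E2 expr2 {2}E4 -S4 I4; ring.
Qed.

Lemma psi3_eul : thprod (1 : R) 3 2 * (e 2 * e 12) = e 4 * e 6 ^+ 2.
Proof.
have I2 : iprod (1 : R) 2 2 =
    iprod (1 : R) 6 2 * iprod (1 : R) 6 4 * iprod (1 : R) 6 6 :=
  @iprod_split3 1 2 2 isT isT.
have E4 : iprod (1 : R) 2 2 * e 2 = e 4 := @iprod_eul 2 isT.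
have E12 : iprod (1 : R) 6 6 * e 6 = e 12 := @iprod_eul 6 isT.
have T : thprod (1 : R) 3 2 = e 6 * iprod (1 : R) 6 4 * iprod (1 : R) 6 2 by [].
by rewrite T -E4 -E12 I2; ring.
Qed.

Lemma phi_eul : thprod (-1 : R) 1 1 * e 2 = e 1 ^+ 2.
Proof.
have E1 : e 1 = iprod (-1 : R) 2 1 * e 2 := @iprod_split2 (-1) 1 1 isT isT.
have T : thprod (-1 : R) 1 1 = e 2 * iprod (-1 : R) 2 1 * iprod (-1 : R) 2 1 by [].
by rewrite T E1; ring.
Qed.

Lemma phi3_eul : thprod (-1 : R) 3 1 * (e 2 * e 3) = e 1 * e 6 ^+ 2.
Proof.
have E1 : e 1 = iprod (-1 : R) 2 1 * e 2 := @iprod_split2 (-1) 1 1 isT isT.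
have I2 : iprod (-1 : R) 2 1 =
    iprod (-1 : R) 6 1 * iprod (-1 : R) 6 3 * iprod (-1 : R) 6 5 :=
  @iprod_split3 (-1) 2 1 isT isT.
have E3 : e 3 = iprod (-1 : R) 6 3 * e 6 := @iprod_split2 (-1) 3 3 isT isT.
have T : thprod (-1 : R) 3 1 = e 6 * iprod (-1 : R) 6 5 * iprod (-1 : R) 6 1 by [].
by rewrite T E1 I2 E3; ring.
Qed.

Lemma rescale_dil z k f : z ^+ k.+1 = 1 -> rescale z (dil k f) = dil k f.
Proof.
move=> zk; apply: funext => n; rewrite /rescale /dil.
case: ifP => [/dvdnP[m ->]|_]; last by rewrite mulr0.
by rewrite mulnC exprM zk expr1n mul1r.
Qed.

Lemma dil_dil k l f : dil k (dil l f) = dil (k.+1 * l.+1).-1 f.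
Proof.
apply: eqXP => N; have E := eqX_trunc N f.
apply: eqX_trans (eqX_dil k (eqX_dil l E)) _.
apply: eqX_trans (eqX_sym (eqX_dil _ E)).
by rewrite !dil_poly -comp_polyA comp_Xn_poly -exprM.
Qed.

Variable w : R.
Hypothesis w0 : w ^+ 2 + w + 1 = 0.

Let w3 : w ^+ 3 = 1.
Proof. exact: cube_root_expr3. Qed.
Let w23 : (w ^+ 2) ^+ 3 = 1. Proof. by rewrite -exprM mulnC exprM w3 expr1n. Qed.

Definition norm3 f := f * rescale w f * rescale (w ^+ 2) f.

Lemma norm3M f g : norm3 (f * g) = norm3 f * norm3 g.
Proof. by rewrite /norm3 !rmorphM /=; ring. Qed.

(** The three conjugates are [f + g], [f + v g] and [f + v^2 g]. *)
Lemma norm3D f g (v : R) : v ^+ 2 + v + 1 = 0 ->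
    rescale w f = f -> rescale (w ^+ 2) f = f ->
    rescale w g = cst v * g -> rescale (w ^+ 2) g = cst (v ^+ 2) * g ->
  norm3 (f + g) = f ^+ 3 + g ^+ 3.
Proof.
move=> v0 f1 f2 g1 g2; rewrite /norm3 !rmorphD /= f1 f2 g1 g2 rmorphXn /=.
have := cst_cube_root v0.
move: (cst v) => x x0.
rewrite [LHS](_ : _ = f ^+ 3 + (f ^+ 2 * g + x * f * g ^+ 2) * (x ^+ 2 + x + 1)
  + g ^+ 3 + g ^+ 3 * (x - 1) * (x ^+ 2 + x + 1)); last by ring.
by rewrite x0; ring.
Qed.

Lemma eul_mulI c k : (0 < c)%N -> injective (GRing.mul (e c ^+ k)).
Proof. by move=> c0; apply/mulrI/unitrX/fps_unit1/eul0. Qed.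

(** The norm of [P = psi(q^2)] is computed from [norm_eul] in [NP] and from the dissection in [DP].
    Both are series in [q^3], and [K] compares them with [q] in place of [q^3]. *)
Lemma psi_cubic :
  e 1 * e 2 ^+ 3 * e 3 ^+ 9 + q * e 1 ^+ 4 * e 6 ^+ 9 = e 2 ^+ 8 * e 3 ^+ 4 * e 6.
Proof.
have [P [F [Pe Fe Ds]]] : exists P F, [/\ P * e 2 = e 4 ^+ 2,
    F * (e 2 * e 12) = e 4 * e 6 ^+ 2 & P = dil 2 F + q ^+ 2 * dil 8 P].
  exists (thprod 1 4 2), (thprod 1 3 2).
  by split; [apply: psi_eul | apply: psi3_eul | apply: psi_dissection].
have N2 : norm3 (e 2) * e 18 = e 6 ^+ 4 := @norm_eul R w 2 w0 isT isT.
have N4 : norm3 (e 4) * e 36 = e 12 ^+ 4 := @norm_eul R w 4 w0 isT isT.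
have NP : norm3 P * e 6 ^+ 4 * e 36 ^+ 2 = e 12 ^+ 8 * e 18.
  have NPe : norm3 P * norm3 (e 2) = norm3 (e 4) ^+ 2.
    by rewrite -norm3M Pe !expr2 norm3M.
  rewrite -N2 [LHS](_ : _ = norm3 P * norm3 (e 2) * e 18 * e 36 ^+ 2); last by ring.
  rewrite NPe [e 12 ^+ 8](_ : _ = (e 12 ^+ 4) ^+ 2); last by ring.
  by rewrite -N4; ring.
have DP : norm3 P = dil 2 (F ^+ 3 + q ^+ 2 * dil 2 P ^+ 3).
  have D8 : dil 8 P = dil 2 (dil 2 P) by rewrite dil_dil.
  (* The second part is [q^2] times a series in [q^3], so [q -> w q] multiplies it by [w^2]. *)
  rewrite {1}Ds (@norm3D _ _ (w ^+ 2)).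
  - by rewrite D8 rmorphD !(rmorphXn, rmorphM) /= dil_qv; ring.
  - by rewrite -[RHS]w0 -exprM (exprD w 3 1) w3; ring.
  - by rewrite rescale_dil.
  - by rewrite rescale_dil.
  - rewrite !(rmorphXn, rmorphM) /= rescale_qv D8 rescale_dil // ?rmorphXn /=; ring.
  - by rewrite !(rmorphXn, rmorphM) /= rescale_qv D8 rescale_dil // ?rmorphXn /=; ring.
have E3P : dil 2 P * e 6 = e 12 ^+ 2.
  have := congr1 (dil 2) Pe.
  by rewrite !(rmorphXn, rmorphM) /= !dil_eul.
have K : (F ^+ 3 + q ^+ 2 * dil 2 P ^+ 3) * e 2 ^+ 4 * e 12 ^+ 2 = e 4 ^+ 8 * e 6.
  move: DP; move: (F ^+ 3 + _) => Z DP.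
  by apply: (@dil_inj _ 2); rewrite !(rmorphXn, rmorphM) /= -DP !dil_eul.
(* [K] is the goal at [q^2], once [F] and [dil 2 P] are replaced by eta quotients; multiplying by
   cubes below supplies their denominators. *)
apply: (@dil_inj _ 1); rewrite !(rmorphXn, rmorphM, rmorphD) /= dil_qv !dil_eul //.
rewrite -!/(e 2) -!/(e 4) -!/(e 6) -!/(e 12).
apply: (@eul_mulI 2 3 isT); apply: (@eul_mulI 12 2 isT).
have := congr1 (fun x => x * (e 2 ^+ 3 * e 6 ^+ 3 * e 12 ^+ 3)) K => /= {}K.
transitivity (e 4 ^+ 8 * e 6 * (e 2 ^+ 3 * e 6 ^+ 3 * e 12 ^+ 3)); last by ring.
rewrite -K [RHS](_ : _ = (F * (e 2 * e 12)) ^+ 3 * e 6 ^+ 3 * e 2 ^+ 4 * e 12 ^+ 2 +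
  q ^+ 2 * (dil 2 P * e 6) ^+ 3 * e 2 ^+ 7 * e 12 ^+ 5); last by ring.
rewrite Fe E3P; ring.
Qed.

(** The same comparison for [phi(-q)]. The second part now has exponents 1 modulo 3, and its
    coefficient 2 is cubed to 8. *)
Lemma phi_cubic :
  e 2 ^+ 4 * e 3 ^+ 9 - (q * e 1 ^+ 3 * e 2 * e 6 ^+ 9) *+ 8 =
  e 1 ^+ 8 * e 3 * e 6 ^+ 4.
Proof.
have [P [F [Pe Fe Ds]]] : exists P F, [/\ P * e 2 = e 1 ^+ 2,
    F * (e 2 * e 3) = e 1 * e 6 ^+ 2 & P = dil 8 P - (q * dil 2 F) *+ 2].
  exists (thprod (-1) 1 1), (thprod (-1) 3 1).
  by split; [apply: phi_eul | apply: phi3_eul | apply: phi_dissection].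
have N2 : norm3 (e 2) * e 18 = e 6 ^+ 4 := @norm_eul R w 2 w0 isT isT.
have N1 : norm3 (e 1) * e 9 = e 3 ^+ 4 := @norm_eul R w 1 w0 isT isT.
have NP : norm3 P * e 6 ^+ 4 * e 9 ^+ 2 = e 3 ^+ 8 * e 18.
  have NPe : norm3 P * norm3 (e 2) = norm3 (e 1) ^+ 2.
    by rewrite -norm3M Pe !expr2 norm3M.
  rewrite -N2 [LHS](_ : _ = norm3 P * norm3 (e 2) * e 18 * e 9 ^+ 2); last by ring.
  rewrite NPe [e 3 ^+ 8](_ : _ = (e 3 ^+ 4) ^+ 2); last by ring.
  by rewrite -N1; ring.
have DP : norm3 P = dil 2 (dil 2 P ^+ 3 - (q * F ^+ 3) *+ 8).
  have D8 : dil 8 P = dil 2 (dil 2 P) by rewrite dil_dil.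
  rewrite {1}Ds (@norm3D _ _ w) //.
  - by rewrite D8 rmorphB rmorphMn !(rmorphXn, rmorphM) /= dil_qv; ring.
  - by rewrite D8 rescale_dil.
  - by rewrite D8 rescale_dil.
  - by rewrite rmorphN rmorphMn rmorphM /= rescale_qv rescale_dil //; ring.
  - by rewrite rmorphN rmorphMn rmorphM /= rescale_qv rescale_dil //; ring.
have E3P : dil 2 P * e 6 = e 3 ^+ 2.
  have := congr1 (dil 2) Pe.
  by rewrite !(rmorphXn, rmorphM) /= !dil_eul.
have K : (dil 2 P ^+ 3 - (q * F ^+ 3) *+ 8) * e 2 ^+ 4 * e 3 ^+ 2 = e 1 ^+ 8 * e 6.
  move: DP; move: (dil 2 P ^+ 3 - _) => Z DP.
  by apply: (@dil_inj _ 2); rewrite !(rmorphXn, rmorphM) /= -DP !dil_eul.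
apply: (@eul_mulI 2 3 isT); apply: (@eul_mulI 3 2 isT).
have := congr1 (fun x => x * (e 2 ^+ 3 * e 3 ^+ 3 * e 6 ^+ 3)) K => /= {}K.
transitivity (e 1 ^+ 8 * e 6 * (e 2 ^+ 3 * e 3 ^+ 3 * e 6 ^+ 3)); last by ring.
rewrite -K [RHS](_ : _ = (dil 2 P * e 6) ^+ 3 * e 2 ^+ 7 * e 3 ^+ 5 -
  (q * (F * (e 2 * e 3)) ^+ 3 * e 6 ^+ 3 * e 2 ^+ 4 * e 3 ^+ 2) *+ 8); last by ring.
rewrite Fe E3P; ring.
Qed.
End CubicIdentities.

(** * Descent of the cubic relations from algebraic numbers to integers *)

Section Map.
Variables (R S : comNzRingType) (phi : {rmorphism R -> S}).

Definition fps_map (f : fps R) : fps S := fun n => phi (f n).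

Lemma fps_map_is_zmod_morphism : zmod_morphism fps_map.
Proof. by move=> f g; apply: funext => n; rewrite /fps_map rmorphB. Qed.
Lemma fps_map_is_monoid_morphism : monoid_morphism fps_map.
Proof.
split=> [|f g]; apply: funext => n; first by rewrite /fps_map rmorph_nat.
by rewrite /fps_map !fps_coefM rmorph_sum; apply: eq_bigr => k _; rewrite rmorphM.
Qed.
HB.instance Definition _ := GRing.isZmodMorphism.Build (fps R) (fps S)
  fps_map fps_map_is_zmod_morphism.
HB.instance Definition _ := GRing.isMonoidMorphism.Build (fps R) (fps S)
  fps_map fps_map_is_monoid_morphism.

Lemma fps_map_poly p : fps_map (fps_of_poly p) = fps_of_poly (map_poly phi p).
Proof. by apply: funext => n; rewrite /fps_map /fps_of_poly coef_map. Qed.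

Lemma fps_map_inj : injective phi -> injective fps_map.
Proof.
move=> phi_inj f g E; apply: funext => n.
exact: phi_inj (congr1 (fun h : fps S => h n) E).
Qed.

Lemma fps_map_qv : fps_map (qv R) = qv S.
Proof. by rewrite /qv fps_map_poly map_polyX. Qed.

Lemma fps_map_eul c : fps_map (eul R c) = eul S c.
Proof.
apply: funext => n; rewrite /eul /iprod.
transitivity (fps_map (\prod_(m < n.+1) fac (-1) (c * m + c)) n) => //.
rewrite rmorph_prod; congr (_ n); apply: eq_bigr => m _.
rewrite /fac rmorphD rmorph1 rmorphM rmorphXn /= fps_map_qv.
by rewrite /cst fps_map_poly map_polyC /= (rmorphN1 phi).
Qed.
End Map.

Lemma cube_root_unity : exists w : algC, w ^+ 2 + w + 1 = 0.
Proof.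
have [z zP] := C_prim_root_exists (isT : (0 < 3)%N); exists z.
have : (z - 1) * (z ^+ 2 + z + 1) = 0.
  rewrite [LHS](_ : _ = z ^+ 3 - 1); last by ring.
  by rewrite (prim_expr_order zP) subrr.
move/eqP; rewrite mulf_eq0 subr_eq0 => /orP[|/eqP //].
by rewrite -[z]expr1 -(prim_order_dvd zP).
Qed.

Local Notation q := (qv int).
Local Notation e := (eul int).

Lemma psi_cubic_int :
  e 1 * e 2 ^+ 3 * e 3 ^+ 9 + q * e 1 ^+ 4 * e 6 ^+ 9 = e 2 ^+ 8 * e 3 ^+ 4 * e 6.
Proof.
have [w w0] := cube_root_unity.
have gen (f : {rmorphism fps int -> fps algC}) x y1 y2 y3 y6 : injective f ->
    f y1 * f y2 ^+ 3 * f y3 ^+ 9 + f x * f y1 ^+ 4 * f y6 ^+ 9 =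
      f y2 ^+ 8 * f y3 ^+ 4 * f y6 ->
    y1 * y2 ^+ 3 * y3 ^+ 9 + x * y1 ^+ 4 * y6 ^+ 9 = y2 ^+ 8 * y3 ^+ 4 * y6.
  by move=> f_inj; rewrite -!rmorphXn -!rmorphM -rmorphD => /f_inj.
apply: (gen (fps_map (intr : int -> algC))); first exact/fps_map_inj/intr_inj.
by rewrite /= fps_map_qv !fps_map_eul (psi_cubic w0).
Qed.

Lemma phi_cubic_int :
  e 2 ^+ 4 * e 3 ^+ 9 - (q * e 1 ^+ 3 * e 2 * e 6 ^+ 9) *+ 8 =
  e 1 ^+ 8 * e 3 * e 6 ^+ 4.
Proof.
have [w w0] := cube_root_unity.
have gen (f : {rmorphism fps int -> fps algC}) x y1 y2 y3 y6 : injective f ->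
    f y2 ^+ 4 * f y3 ^+ 9 - (f x * f y1 ^+ 3 * f y2 * f y6 ^+ 9) *+ 8 =
      f y1 ^+ 8 * f y3 * f y6 ^+ 4 ->
    y2 ^+ 4 * y3 ^+ 9 - (x * y1 ^+ 3 * y2 * y6 ^+ 9) *+ 8 = y1 ^+ 8 * y3 * y6 ^+ 4.
  by move=> f_inj; rewrite -!rmorphXn -!rmorphM -rmorphMn -rmorphB => /f_inj.
apply: (gen (fps_map (intr : int -> algC))); first exact/fps_map_inj/intr_inj.
by rewrite /= fps_map_qv !fps_map_eul (phi_cubic w0).
Qed.

(** * The Hauptmodul of level 12 *)

(* Locked because unification would otherwise compare distinct eta quotients by
   unfolding the infinite products. *)
HB.lock Definition eta (a1 a2 a3 a4 a6 a12 : int) : fps int :=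
  e 1 ^ a1 * e 2 ^ a2 * e 3 ^ a3 * e 4 ^ a4 * e 6 ^ a6 * e 12 ^ a12.

Lemma eul_unit c : (0 < c)%N -> e c \is a GRing.unit.
Proof. by move=> c0; apply/fps_unit1/eul0. Qed.

Lemma etaM a1 a2 a3 a4 a6 a12 b1 b2 b3 b4 b6 b12 :
  eta a1 a2 a3 a4 a6 a12 * eta b1 b2 b3 b4 b6 b12 =
  eta (a1 + b1) (a2 + b2) (a3 + b3) (a4 + b4) (a6 + b6) (a12 + b12).
Proof. by rewrite eta.unlock !exprzDr ?eul_unit //; ring. Qed.

Lemma eta0 : eta 0 0 0 0 0 0 = 1.
Proof. by rewrite eta.unlock !expr0z !mulr1. Qed.

(** The exponent sums appear as boolean tests, which computation settles for numerals. *)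
Lemma eta_mul a1 a2 a3 a4 a6 a12 b1 b2 b3 b4 b6 b12 c1 c2 c3 c4 c6 c12 :
  [&& a1 + b1 == c1, a2 + b2 == c2 & a3 + b3 == c3] &&
  [&& a4 + b4 == c4, a6 + b6 == c6 & a12 + b12 == c12] ->
  eta a1 a2 a3 a4 a6 a12 * eta b1 b2 b3 b4 b6 b12 = eta c1 c2 c3 c4 c6 c12.
Proof.
by move=> /andP[/and3P[/eqP<- /eqP<- /eqP<-] /and3P[/eqP<- /eqP<- /eqP<-]]; apply: etaM.
Qed.

Lemma eta_exp a1 a2 a3 a4 a6 a12 n :
  eta a1 a2 a3 a4 a6 a12 ^+ n =
  eta (a1 *+ n) (a2 *+ n) (a3 *+ n) (a4 *+ n) (a6 *+ n) (a12 *+ n).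
Proof. by elim: n => [|n IH]; rewrite ?eta0 // exprS IH etaM !mulrS. Qed.

Lemma rmorph_monomial (A B : comUnitRingType) (f : {rmorphism A -> B})
    (x1 x2 x3 x4 x5 x6 : A) (a1 a2 a3 a4 a5 a6 : int) :
  [/\ x1 \is a GRing.unit, x2 \is a GRing.unit & x3 \is a GRing.unit] ->
  [/\ x4 \is a GRing.unit, x5 \is a GRing.unit & x6 \is a GRing.unit] ->
  f (x1 ^ a1 * x2 ^ a2 * x3 ^ a3 * x4 ^ a4 * x5 ^ a5 * x6 ^ a6) =
  f x1 ^ a1 * f x2 ^ a2 * f x3 ^ a3 * f x4 ^ a4 * f x5 ^ a5 * f x6 ^ a6.
Proof. by move=> [u1 u2 u3] [u4 u5 u6]; rewrite !rmorphM !rmorphXz. Qed.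

Lemma rmorph_eta (B : comUnitRingType) (f : {rmorphism fps int -> B})
    a1 a2 a3 a4 a6 a12 :
  f (eta a1 a2 a3 a4 a6 a12) =
  f (e 1) ^ a1 * f (e 2) ^ a2 * f (e 3) ^ a3 * f (e 4) ^ a4 * f (e 6) ^ a6 *
  f (e 12) ^ a12.
Proof. by rewrite eta.unlock; apply: rmorph_monomial; split; apply: eul_unit. Qed.

Lemma dil_eta a1 a2 a3 a6 :
  dil 1 (eta a1 a2 a3 0 a6 0) = eta 0 a1 0 a2 a3 a6.
Proof.
by rewrite rmorph_eta /= !dil_eul // eta.unlock !expr0z !mulr1 mul1r.
Qed.

(** Under [q -> -q] the factors of odd exponent pass from [1 - u] to [1 + u]; multiplied by the old
    ones they give [1 - u^2]. *)
Lemma rescale_eul c : odd c -> rescale (-1) (e c) * (e c * e (4 * c)) = e (2 * c) ^+ 3.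
Proof.
move=> oc; have c0 : (0 < c)%N by case: c oc.
have E1 : e c = iprod (-1 : int) (2 * c) c * e (2 * c).
  by rewrite {1}/eul iprod_split2 // addnn -mul2n.
have E2 : e (2 * c) = iprod (-1 : int) (4 * c) (2 * c) * e (4 * c).
  by rewrite {1}/eul iprod_split2 ?muln_gt0 // addnn -mul2n !mulnA.
have c2 : (0 < 2 * c)%N by rewrite muln_gt0.
have m1 : (-1) ^+ (2 * c) = 1 :> int by rewrite exprM sqrrN !expr1n.
have R1 : rescale (-1 : int) (iprod (-1) (2 * c) c) = iprod 1 (2 * c) c.
  by rewrite rescale_iprod // -signr_odd oc expr1 mulN1r opprK.
have R2 : rescale (-1) (e (2 * c)) = e (2 * c).
  by rewrite rescale_iprod // m1 mulr1.
have S : iprod (1 : int) (2 * c) c * iprod (-1) (2 * c) c =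
    iprod (-1 : int) (4 * c) (2 * c).
  by rewrite iprod_sq // expr1n !mulnA.
rewrite {1}E1 rmorphM /= R1 R2 E1.
rewrite [LHS](_ : _ = iprod 1 (2 * c) c * iprod (-1) (2 * c) c * e (4 * c) *
  e (2 * c) ^+ 2); last by ring.
by rewrite S -E2 -exprS.
Qed.

Lemma rescale_eul_even c : (0 < c)%N -> rescale (-1) (e (2 * c)) = e (2 * c).
Proof.
move=> c0; have m1 : (-1) ^+ (2 * c) = 1 :> int by rewrite exprM sqrrN !expr1n.
by rewrite rescale_iprod ?muln_gt0 // m1 mulr1.
Qed.

Lemma monomial_subst (A : idomainType) (x1 x2 x3 x4 x6 x12 : A)
    (a1 a2 a3 a4 a6 a12 : int) :
  [/\ x1 \is a GRing.unit, x2 \is a GRing.unit & x3 \is a GRing.unit] ->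
  [/\ x4 \is a GRing.unit, x6 \is a GRing.unit & x12 \is a GRing.unit] ->
  (x1^-1 * x2 ^+ 3 * x4^-1) ^ a1 * x2 ^ a2 * (x3^-1 * x6 ^+ 3 * x12^-1) ^ a3 *
  x4 ^ a4 * x6 ^ a6 * x12 ^ a12 =
  x1 ^ (- a1) * x2 ^ (a2 + 3 * a1) * x3 ^ (- a3) * x4 ^ (a4 - a1) *
  x6 ^ (a6 + 3 * a3) * x12 ^ (a12 - a3).
Proof.
move=> [u1 u2 u3] [u4 u6 u12].
have key (x y z : A) a : x \is a GRing.unit -> y \is a GRing.unit ->
    z \is a GRing.unit ->
    (x^-1 * y ^+ 3 * z^-1) ^ a = x ^ (- a) * y ^ (3 * a) * z ^ (- a).
  move=> ux uy uz; have -> : y ^ (3 * a) = (y ^+ 3) ^ a by rewrite exprnP exprz_exp.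
  have : y ^+ 3 \is a GRing.unit by rewrite unitrX.
  move: (y ^+ 3) => u uu; rewrite !exprzMl ?unitrM ?unitrV ?ux ?uu ?uz //.
  by rewrite -!exprN1 !exprz_exp !mulN1r.
rewrite !key // !exprzDr //; move: (x1 ^ _) (x3 ^ (- _)) => y1 y3.
move: (x2 ^ a2) (x2 ^ (_ * _)) (x4 ^ a4) (x4 ^ _) => y2 z2 y4 z4.
by move: (x6 ^ a6) (x6 ^ (_ * _)) (x12 ^ a12) (x12 ^ _) => *; ring.
Qed.

Lemma rescale_eta a1 a2 a3 a4 a6 a12 :
  rescale (-1) (eta a1 a2 a3 a4 a6 a12) =
  eta (- a1) (a2 + 3 * a1) (- a3) (a4 - a1) (a6 + 3 * a3) (a12 - a3).
Proof.
have U := eul_unit.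
have key (x y z u : fps int) : y \is a GRing.unit -> z \is a GRing.unit ->
    x * (y * z) = u -> x = y^-1 * u * z^-1.
  move=> uy uz <-; rewrite [RHS](_ : _ = x * (y * y^-1) * (z * z^-1)); last by ring.
  by rewrite !mulrV ?mulr1.
have R1 : rescale (-1) (e 1) = (e 1)^-1 * e 2 ^+ 3 * (e 4)^-1.
  by apply: key; [apply: U | apply: U | apply: (@rescale_eul 1)].
have R3 : rescale (-1) (e 3) = (e 3)^-1 * e 6 ^+ 3 * (e 12)^-1.
  by apply: key; [apply: U | apply: U | apply: (@rescale_eul 3)].
have R2 : rescale (-1) (e 2) = e 2 := @rescale_eul_even 1 isT.
have R4 : rescale (-1) (e 4) = e 4 := @rescale_eul_even 2 isT.
have R6 : rescale (-1) (e 6) = e 6 := @rescale_eul_even 3 isT.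
have R12 : rescale (-1) (e 12) = e 12 := @rescale_eul_even 6 isT.
rewrite rmorph_eta /= R1 R2 R3 R4 R6 R12.
by rewrite eta.unlock; apply: monomial_subst; split; apply: U.
Qed.

(* Everything is expressed through the Hauptmodul [t] of level 12, which is odd
   in [q]; [eta_b] and [eta_d] are [eta_a] and [eta_c] at [-q]. *)
Definition eta_t := q * eta 0 2 0 (-4) (-2) 4.
Definition eta_a := eta (-1) 2 3 (-3) (-2) 1.
Definition eta_b := eta 1 (-1) (-3) (-2) 7 (-2).
Definition eta_c := eta (-3) 9 1 (-6) (-3) 2.
Definition eta_d := eta 3 0 (-1) (-3) 0 1.
Definition eta_xi := eta (-1) 5 (-5) 0 1 0.

Lemma eta_nat (a1 a2 a3 a6 : nat) : eta a1 a2 a3 0 a6 0 =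
  e 1 ^+ a1 * e 2 ^+ a2 * e 3 ^+ a3 * e 6 ^+ a6.
Proof. by rewrite eta.unlock !expr0z !mulr1. Qed.

Lemma level6_psi : eta 1 (-5) 5 0 (-1) 0 = 1 - q * eta 4 (-8) (-4) 0 8 0.
Proof.
have E : eta 1 3 9 0 0 0 + q * eta 4 0 0 0 9 0 = eta 0 8 4 0 1 0.
  rewrite (eta_nat 1 3 9 0) (eta_nat 4 0 0 9) (eta_nat 0 8 4 1).
  have := psi_cubic_int; move: (qv int) (e 1) (e 2) (e 3) (e 6) => x e1 e2 e3 e6 H.
  by rewrite !expr0 !expr1 !mulr1 !mul1r -H mulrA.
pose u := eta 0 (-8) (-4) 0 (-1) 0.
have E1 : eta 1 3 9 0 0 0 * u = eta 1 (-5) 5 0 (-1) 0 by apply: eta_mul.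
have E2 : eta 4 0 0 0 9 0 * u = eta 4 (-8) (-4) 0 8 0 by apply: eta_mul.
have E3 : eta 0 8 4 0 1 0 * u = 1 by rewrite -eta0; apply: eta_mul.
by rewrite -E1 -E2 -E3 -E mulrDl mulrA addrK.
Qed.

(** Dividing [phi_cubic_int] leaves the quotient of [level6_psi] minus 8 times its [q] term, and
    [1 + 8 = 9]. *)
Lemma level6_phi : eta 9 (-9) (-3) 0 3 0 = 1 - (q * eta 4 (-8) (-4) 0 8 0) *+ 9.
Proof.
have E : eta 0 4 9 0 0 0 - (q * eta 3 1 0 0 9 0) *+ 8 = eta 8 0 1 0 4 0.
  rewrite (eta_nat 0 4 9 0) (eta_nat 3 1 0 9) (eta_nat 8 0 1 4).
  have := phi_cubic_int; move: (qv int) (e 1) (e 2) (e 3) (e 6) => x e1 e2 e3 e6 H.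
  by rewrite !expr0 !expr1 !mulr1 !mul1r -H !mulrA.
pose u := eta 1 (-9) (-4) 0 (-1) 0.
have E1 : eta 8 0 1 0 4 0 * u = eta 9 (-9) (-3) 0 3 0 by apply: eta_mul.
have E2 : eta 3 1 0 0 9 0 * u = eta 4 (-8) (-4) 0 8 0 by apply: eta_mul.
have E3 : eta 0 4 9 0 0 0 * u = eta 1 (-5) 5 0 (-1) 0 by apply: eta_mul.
rewrite -E1 -E mulrBl E3 level6_psi mulrnAl -mulrA E2; move: (q * _) => x; ring.
Qed.

Lemma eta_sqr_t : eta_t ^+ 2 = q ^+ 2 * eta 0 4 0 (-8) (-4) 8.
Proof. by rewrite /eta_t exprMn; congr (_ * _); rewrite expr2; apply: eta_mul. Qed.

(** This is [level6_psi] at [q^2], as [eta_cd] is [level6_phi] at [q^2]. *)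
Lemma eta_ab : eta_a * eta_b = 1 - eta_t ^+ 2.
Proof.
have := congr1 (dil 1) level6_psi; rewrite rmorphB rmorph1 rmorphM /= dil_qv !dil_eta.
by rewrite eta_sqr_t => <-; apply: eta_mul.
Qed.

Lemma eta_cd : eta_c * eta_d = 1 - eta_t ^+ 2 *+ 9.
Proof.
have := congr1 (dil 1) level6_phi.
rewrite rmorphB rmorph1 rmorphMn rmorphM /= dil_qv !dil_eta.
by rewrite eta_sqr_t => <-; apply: eta_mul.
Qed.

(** This is [level6_psi] at [q], multiplied by [eta_c]. *)
Lemma eta_cE : eta_c = eta_a ^+ 2 + eta_t * eta_b.
Proof.
have E1 : eta 1 (-5) 5 0 (-1) 0 * eta_c = eta_a ^+ 2.
  rewrite expr2.
  by transitivity (eta (-2) 4 6 (-6) (-4) 2); [|symmetry]; apply: eta_mul.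
have E2 : eta 4 (-8) (-4) 0 8 0 * eta_c = eta 0 2 0 (-4) (-2) 4 * eta_b.
  by transitivity (eta 1 1 (-3) (-6) 5 2); [|symmetry]; apply: eta_mul.
by rewrite -E1 level6_psi /eta_t -mulrA -E2; move: eta_c (eta _ _ _ _ _ _) => x y; ring.
Qed.

Lemma rescale_eta_t : rescale (-1) eta_t = - eta_t.
Proof.
rewrite /eta_t rmorphM /= rescale_qv rescale_eta rmorphN1 !mulN1r mulNr.
by congr (- (_ * eta _ _ _ _ _ _)).
Qed.

Lemma rescale_eta_a : rescale (-1) eta_a = eta_b.
Proof. by rewrite /eta_a rescale_eta; congr (eta _ _ _ _ _ _). Qed.
Lemma rescale_eta_b : rescale (-1) eta_b = eta_a.
Proof. by rewrite /eta_b rescale_eta; congr (eta _ _ _ _ _ _). Qed.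
Lemma rescale_eta_c : rescale (-1) eta_c = eta_d.
Proof. by rewrite /eta_c rescale_eta; congr (eta _ _ _ _ _ _). Qed.

Lemma eta_dE : eta_d = eta_b ^+ 2 - eta_t * eta_a.
Proof.
rewrite -rescale_eta_c eta_cE rmorphD (rmorphXn _ 2 eta_a) (rmorphM _ eta_t eta_b) /=.
by rewrite rescale_eta_a rescale_eta_b rescale_eta_t mulNr.
Qed.

Lemma eta_coef0 a1 a2 a3 a4 a6 a12 : eta a1 a2 a3 a4 a6 a12 0%N = 1.
Proof.
have V (x : fps int) : x 0%N = 1 -> x^-1 0%N = 1.
  move=> x1; have := congr1 (fun y : fps int => y 0%N) (mulrV (fps_unit1 x1)).
  by rewrite /= fps_coefM0 x1 mul1r.
have Z c n : (0 < c)%N -> (e c ^ n) 0%N = 1.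
  move=> c0; have e1 := eul0 int c0.
  by case: n => n; [rewrite -exprnP | rewrite NegzE -exprnN; apply: V];
    rewrite fps_coefX0 e1 expr1n.
by rewrite eta.unlock !fps_coefM0 !Z.
Qed.

Lemma eta_t_coef0 : eta_t 0%N = 0.
Proof. by rewrite /eta_t fps_coefM0 -[q]expr1 qvX mul0r. Qed.

Lemma eta_t_neq0 : eta_t != 0.
Proof.
rewrite mulf_neq0 //; apply/eqP => /(congr1 (fun f : fps int => (f 0%N, f 1%N))).
  by rewrite -[q]expr1 !qvX.
by rewrite eta_coef0.
Qed.

Lemma fps_neq0 (f : fps int) : f 0%N != 0 -> f != 0.
Proof. by apply: contraNneq => ->. Qed.

Lemma hauptmodul_a : eta_a = 1 + eta_t.
Proof.
have [[[ab cd] cE] dE] := (eta_ab, eta_cd, eta_cE, eta_dE); move: ab cd cE dE.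
have [t0 t1 a0 b0] : [/\ eta_t 0%N = 0, eta_t != 0, eta_a 0%N = 1 & eta_b 0%N = 1].
  by split; [exact: eta_t_coef0 | exact: eta_t_neq0 | exact: eta_coef0 ..].
move: eta_a eta_b eta_c eta_d eta_t t0 t1 a0 b0 => a b c d t t0 t1 a0 b0 ab + cE dE.
rewrite cE dE => cd; pose s := a - b.
(* Given [a b = 1 - t^2], the relation for [c d] becomes this cubic in [s]. Its quadratic factor has
   constant term 3, hence is nonzero. *)
have : t * ((s - t *+ 2) * (s ^+ 2 + t * s *+ 2 + 3 + t ^+ 2)) = 0.
  have -> : t * ((s - t *+ 2) * (s ^+ 2 + t * s *+ 2 + 3 + t ^+ 2)) =
      (a * b - (1 - t ^+ 2)) * (a * b + (1 - t ^+ 2) - t * s *+ 3 - t ^+ 2) -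
      ((a ^+ 2 + t * b) * (b ^+ 2 - t * a) - (1 - t ^+ 2 *+ 9)) by rewrite /s; ring.
  by rewrite ab cd !subrr mul0r subrr.
move/eqP; rewrite !mulf_eq0 (negPf t1) /= => /orP[|]; last first.
  apply/contraTeq => _; apply: fps_neq0.
  rewrite !fps_coefD !fps_coefX0 mulr2n !fps_coefD fps_coefM0 /s !fps_coefD.
  by rewrite fps_coefN t0 a0 b0.
rewrite subr_eq0 => /eqP st.
(* With [b = a - 2 t] the relation for [a b] reads [(a - t)^2 = 1]; the constant term of [a] decides
   the sign. *)
have : (a - t - 1) * (a - t + 1) = 0.
  rewrite [LHS](_ : _ = a * b - (1 - t ^+ 2) + a * (s - t *+ 2)).
    2: by rewrite /s; ring.
  by rewrite ab st !subrr mulr0 addr0.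
move/eqP; rewrite mulf_eq0 => /orP[|]; last first.
  by apply/contraTeq => _; apply: fps_neq0; rewrite !fps_coefD fps_coefN t0 a0.
by rewrite -addrA -opprD subr_eq0 addrC => /eqP.
Qed.

Lemma hauptmodul_b : eta_b = 1 - eta_t.
Proof.
by rewrite -rescale_eta_a hauptmodul_a rmorphD rmorph1 /= rescale_eta_t.
Qed.

Lemma hauptmodul_c : eta_c = 1 + eta_t *+ 3.
Proof. by rewrite eta_cE hauptmodul_a hauptmodul_b; ring. Qed.

Lemma eta_xiE : eta_xi * eta_a ^+ 2 = eta_c.
Proof.
have -> : eta_a ^+ 2 = eta (-2) 4 6 (-6) (-4) 2 by rewrite expr2; apply: eta_mul.
exact: eta_mul.
Qed.

Lemma dil_eta_xi : dil 1 eta_xi * (eta_a * eta_b) = 1.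
Proof.
have -> : eta_a * eta_b = eta 0 1 0 (-5) 5 (-1) by apply: eta_mul.
by rewrite dil_eta -eta0; apply: eta_mul.
Qed.

(** * The polynomials [zeta_(i,1)] *)

Lemma sOneE : sOne = 1 :> fps int.
Proof. by apply: funext => -[|n]. Qed.

Lemma sExpE (f : ser) n : sExp f n = (f : fps int) ^+ n.
Proof.
elim: n => [|n IH]; first exact: sOneE.
by rewrite exprS -IH.
Qed.

Lemma sInvE (f : ser) : f 0%N = 1 -> sInv f = (f : fps int)^-1.
Proof.
move=> f1; rewrite -(@geomE int f f1); apply: funext => n.
by rewrite /sInv /geom; apply: eq_bigr => k _; rewrite sExpE -sOneE.
Qed.

Lemma E_E k : E_ k.+1 = eul int k.+1.
Proof.
have E1 : Eser = eul int 1.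
  apply: funext => n; rewrite /eul /iprod big_ord_recr /=.
  (* [iprod] has one factor more than [Eser], namely [1 - q^(n+1)], which does not affect the
     coefficient of [q^n]. *)
  rewrite (eqXM (@eqX_refl _ n.+1 _) (@fac_eq1 _ n.+1 _ _ _)) //; last by lia.
  transitivity (fps_of_poly (\prod_(1 <= m < n.+1) (1 - 'X^m : {poly int})) n) => //.
  rewrite mulr1 big_add1 big_mkord rmorph_prod; congr (_ n); apply: eq_bigr => m _ /=.
  by rewrite rmorphB rmorph1 rmorphXn /= /fac rmorphN1 mulN1r mul1n addn1.
by rewrite -[k.+1]muln1 -dil_eul // -E1 muln1.
Qed.

Lemma gammaE : gamma = eta 5 5 (-15) 0 5 0.
Proof.
have mono (A : comUnitRingType) (x1 x2 x3 x4 x6 x12 : A) :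
    x1 ^+ 5 * x2 ^+ 5 * x6 ^+ 5 * (x3 ^+ 15)^-1 =
    x1 ^ 5 * x2 ^ 5 * x3 ^ (-15) * x4 ^ 0 * x6 ^ 5 * x12 ^ 0.
  rewrite !expr0z !mulr1; have -> : x3 ^ (-15) = (x3 ^+ 15)^-1 by [].
  by rewrite mulrAC.
rewrite /gamma !sExpE !E_E sInvE ?fps_coefX0 ?eul0 ?expr1n //.
by rewrite eta.unlock -mono.
Qed.

Lemma xiE : xi = eta_xi.
Proof.
have mono (A : comUnitRingType) (x1 x2 x3 x4 x6 x12 : A) :
    x1 \is a GRing.unit -> x3 \is a GRing.unit ->
    x2 ^+ 5 * x6 * (x1 * x3 ^+ 5)^-1 =
    x1 ^ (-1) * x2 ^ 5 * x3 ^ (-5) * x4 ^ 0 * x6 ^ 1 * x12 ^ 0.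
  move=> u1 u3; rewrite !expr0z !mulr1 expr1z exprN1 invrM ?unitrX //.
  have -> : x3 ^ (-5) = (x3 ^+ 5)^-1 by [].
  have -> : x2 ^ 5 = x2 ^+ 5 by [].
  move: (x2 ^+ 5) (x1^-1) (x3 ^- 5) => y z u; ring.
rewrite /xi !sExpE !E_E sInvE; last first.
  by rewrite [LHS]fps_coefM0 fps_coefX0 !eul0 ?expr1n ?mulr1.
by rewrite /eta_xi eta.unlock -mono // eul_unit.
Qed.

Local Notation kap := (kappa : fps int).

Lemma kappa_inv : kap * eta_b ^+ 5 = 1.
Proof.
have g1 : gamma 0%N = 1 by rewrite gammaE eta_coef0.
have -> : kappa = dil 1 gamma ^+ 2 * (gamma : fps int)^-1.
  by rewrite /kappa sExpE sInvE.
have b5 : eta_b ^+ 5 = eta 5 (-5) (-15) (-10) 35 (-10).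
  by rewrite eta_exp; congr (eta _ _ _ _ _ _).
have g2 : dil 1 gamma ^+ 2 = eta 0 10 0 10 (-30) 10.
  by rewrite gammaE dil_eta expr2; apply: eta_mul.
have bg : dil 1 gamma ^+ 2 * eta_b ^+ 5 = gamma.
  by rewrite g2 b5 gammaE; apply: eta_mul.
by rewrite mulrAC bg mulrV // fps_unit1.
Qed.

Definition ev (p : {poly int}) (x : fps int) := (map_poly (@cst int) p).[x].

Lemma cst_inj : injective (@cst int).
Proof.
move=> x y /(congr1 (fun f : fps int => f 0%N)).
by rewrite /cst /fps_of_poly !coefC.
Qed.

Lemma evE p f n : sEvalPoly p f n = ev p f n.
Proof.
rewrite /ev horner_coef size_map_inj_poly ?rmorph0 //; last exact: cst_inj.
rewrite fps_coef_sum; apply: eq_bigr => m _.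
by rewrite coef_map cstM sExpE.
Qed.

Lemma dil_ev k p x : dil k (ev p x) = ev p (dil k x).
Proof.
rewrite /ev -horner_map /= -map_poly_comp; congr (_.[_]).
by apply: eq_map_poly => c; apply: dil_cst.
Qed.

Lemma ev_cons p c x : ev (p * 'X + c%:P) x = ev p x * x + cst c.
Proof. by rewrite /ev rmorphD rmorphM /= map_polyX map_polyC !hornerE. Qed.

(** The constant term of [p] is that of [ev p x], hence 0; then a factor [x] cancels. *)
Lemma ev_transcendental p (x : fps int) : x 0%N = 0 -> x != 0 -> ev p x = 0 -> p = 0.
Proof.
move=> x0 xn; elim/poly_ind: p => [|p c IH] //; rewrite ev_cons => E.
have c0 : c = 0.
  have := congr1 (fun f : fps int => f 0%N) E.
  by rewrite fps_coefD fps_coefM0 x0 mulr0 add0r /cst /fps_of_poly coefC.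
move/eqP: E; rewrite c0 rmorph0 addr0 mulf_eq0 (negPf xn) orbF => /eqP /IH ->.
by rewrite mul0r add0r.
Qed.

(** * Evaluation at [W = xi(q^2)] and even parts in [t] *)

Section Evaluation.
Local Notation t := eta_t.
Local Notation W := (dil 1 eta_xi).

Let W_inv : W * ((1 + t) * (1 - t)) = 1.
Proof. by rewrite -hauptmodul_a -hauptmodul_b dil_eta_xi. Qed.
Let Wt2 : W * t ^+ 2 = W - 1.
Proof. by rewrite -W_inv; ring. Qed.

Lemma xi_neq1 : eta_xi - 1 != 0.
Proof.
apply: contraNneq eta_t_neq0 => /eqP; rewrite subr_eq0 => /eqP x1.
have := Wt2; rewrite x1 rmorph1 mul1r subrr => /eqP.
by rewrite expf_eq0.
Qed.

(** As [xi] has constant term 1, transcendence is applied to [xi - 1] and the shifted polynomial.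
    This makes the polynomial of each [zeta_(i,1)] unique. *)
Lemma ev_xi_inj p p' : ev p eta_xi = ev p' eta_xi -> p = p'.
Proof.
move=> E; apply/eqP; rewrite -subr_eq0; set r := p - p'.
have r0 : ev r eta_xi = 0 by rewrite /ev rmorphB hornerD hornerN -/(ev p _) E subrr.
have : r \Po ('X + 1%:P) = 0.
  apply: (@ev_transcendental _ (eta_xi - 1)); rewrite ?xi_neq1 //.
    by rewrite fps_coefD fps_coefN /eta_xi eta_coef0 fps_coef1 subrr.
  rewrite /ev map_comp_poly horner_comp map_polyXaddC hornerD hornerX hornerC.
  by rewrite rmorph1 subrK.
move/(congr1 (fun u => u \Po ('X - 1%:P))).
by rewrite comp_polyXaddC_K comp_poly0 => ->.
Qed.

Let kappaE : kap = W ^+ 5 * (1 + t) ^+ 5.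
Proof.
transitivity (kap * (1 - t) ^+ 5 * (W ^+ 5 * (1 + t) ^+ 5)).
  rewrite -mulrA [X in _ * X](_ : _ = (W * ((1 + t) * (1 - t))) ^+ 5).
    by rewrite W_inv expr1n mulr1.
  by move: W t => y z; ring.
by rewrite -hauptmodul_b kappa_inv mul1r.
Qed.

Let xi_t : eta_xi = W ^+ 2 * (1 - t) ^+ 2 * (1 + t *+ 3).
Proof.
rewrite -hauptmodul_c -eta_xiE hauptmodul_a.
transitivity (eta_xi * (W * ((1 + t) * (1 - t))) ^+ 2).
  by rewrite W_inv expr1n mulr1.
by move: W t => y z; ring.
Qed.

(** [mu] and [nu'] are [m(t)] and [m(-t)]; [nu'] is unrelated to the valuation [nu]. *)
Let mu := W * (1 + t) ^+ 2.
Let nu' := W * (1 - t) ^+ 2.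

Let mu_nu : mu * nu' = 1.
Proof. by rewrite -[RHS](expr1n _ 2) -W_inv /mu /nu'; move: W t => y z; ring. Qed.
Let mu_add : mu + nu' = W *+ 4 - 2.
Proof.
transitivity (W *+ 2 + (W * t ^+ 2) *+ 2).
  by rewrite /mu /nu'; move: W t => y z; ring.
by rewrite Wt2; move: W => y; ring.
Qed.

Let rescale_W : rescale (-1) W = W.
Proof. by rewrite rescale_dil. Qed.
Let rescale_mu : rescale (-1) mu = nu'.
Proof.
have R : rescale (-1) (1 + t) = 1 - t by rewrite rmorphD rmorph1 /= rescale_eta_t.
by rewrite /mu /nu' (rmorphM _ W) (rmorphXn _ 2 (1 + t)) /= R rescale_W.
Qed.

(** The linear recurrence which, at [W], has characteristic roots [mu] and [nu']. *)
Fixpoint zrec (p0 p1 : {poly int}) k : {poly int} :=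
  if k is k'.+1 then zrec p1 ((4%:P * 'X - 2%:P) * p1 - p0) k' else p0.

Lemma ev_step p0 p1 x :
  ev ((4%:P * 'X - 2%:P) * p1 - p0) x = (x *+ 4 - 2) * ev p1 x - ev p0 x.
Proof.
rewrite /ev rmorphB rmorphM rmorphB rmorphM /= map_polyX !map_polyC /= !hornerE.
by rewrite !rmorph_nat mulr_natl.
Qed.

(** The closed form of the recurrence, doubled to avoid halves; the induction passes from [g], [h]
    to [mu g], [nu' h]. *)
Let zrec_ev p0 p1 g h k :
    ev p0 W *+ 2 = g + h -> ev p1 W *+ 2 = mu * g + nu' * h ->
  ev (zrec p0 p1 k) W *+ 2 = mu ^+ k * g + nu' ^+ k * h.
Proof.
elim: k p0 p1 g h => [|k IH] p0 p1 g h e0 e1 /=; first by rewrite !mul1r.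
rewrite (IH _ _ (mu * g) (nu' * h)) //.
  by rewrite [mu ^+ k.+1]exprSr [nu' ^+ k.+1]exprSr -!(mulrA (_ ^+ k)).
rewrite ev_step mulrnBl -mulrnAr e1 e0 -mu_add.
transitivity ((mu + nu') * (mu * g + nu' * h) - mu * nu' * (g + h)).
  by rewrite mu_nu mul1r.
by move: (mu) (nu') => x y; ring.
Qed.

(** The monomial has exponent [d_ij i 1]. With the [g] of [ev_zpoly], the initial values are the
    even parts in [t] of [g] and [mu g] for even [i], and of [nu' g] and [g] for odd [i], where the
    recurrence starts one index earlier. *)
Definition zpoly (i : nat) : {poly int} :=
  if odd i then
    'X^(5 * i./2 + 3) * zrec (4%:P * 'X + (-3)%:P)
      ((16%:P * 'X + (-18)%:P) * 'X + 3%:P) (5 * i./2).+1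
  else 'X^(5 * i./2 + 1) * zrec ((-4)%:P * 'X + 5%:P) 1%:P (5 * i./2).

Let evXnM n p : ev ('X^n * p) W = W ^+ n * ev p W.
Proof. by rewrite /ev rmorphM /= map_polyXn hornerM hornerXn. Qed.

(** The right side is twice the even part in [q]. Since [q -> -q] sends [t] to [-t], it exchanges
    [mu] and [nu'] and fixes [W], so [zrec_ev] applies. *)
Lemma ev_zpoly i :
  ev (zpoly i) W *+ 2 = kap ^+ i * eta_xi + rescale (-1) (kap ^+ i * eta_xi).
Proof.
have rM (x y z : fps int) m n : rescale (-1) (x ^+ m * (y ^+ n * z)) =
    rescale (-1) x ^+ m * (rescale (-1) y ^+ n * rescale (-1) z).
  by rewrite !rmorphM !rmorphXn.
have rt : rescale (-1) (1 + t *+ 3) = 1 - t *+ 3.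
  by rewrite rmorphD rmorph1 rmorphMn /= rescale_eta_t mulNrn.
have ra : rescale (-1) (1 + t) = 1 - t by rewrite rmorphD rmorph1 /= rescale_eta_t.
have rb : rescale (-1) (1 - t) = 1 + t by rewrite rmorphB rmorph1 /= rescale_eta_t opprK.
(* [kappa^2 = W^10 (1 + t)^10 = (W mu)^5]. *)
have K2 I : kap ^+ (2 * I) = W ^+ (5 * I) * mu ^+ (5 * I) :> fps int.
  rewrite !exprM -exprMn; congr (_ ^+ I); rewrite kappaE /mu.
  move: W t => y z; ring.
rewrite -{2 3}(odd_double_half i) -mul2n /zpoly; set I := i./2.
case: (odd i).
  pose g := W ^+ 2 * ((1 + t) ^+ 3 * (1 + t *+ 3)).
  pose h := W ^+ 2 * ((1 - t) ^+ 3 * (1 - t *+ 3)).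
  have gh : rescale (-1) g = h by rewrite rM rescale_W ra rt.
  have -> : kap ^+ (1 + 2 * I) * eta_xi = W ^+ (5 * I + 3) * (mu ^+ (5 * I) * g).
    rewrite [X in _ * X = _]xi_t exprD expr1 K2 kappaE exprD.
    have -> : g =
        W ^+ 2 * ((1 + t) ^+ 3 * (1 + t *+ 3)) * (W * ((1 + t) * (1 - t))) ^+ 2.
      by rewrite W_inv expr1n mulr1.
    move: (W ^+ (5 * I)) (mu ^+ _) W t => x y z u; ring.
  rewrite rM rescale_W rescale_mu gh evXnM -mulrnAr.
  (* Starting from [nu' g], the power [mu^(5 I + 1)] yields [mu^(5 I) g] because [mu nu' = 1]. *)
  rewrite (zrec_ev (g := nu' * g) (h := mu * h)).
  - have -> : mu ^+ (5 * I).+1 * (nu' * g) = mu ^+ (5 * I) * g * (mu * nu').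
      by rewrite exprS; move: (mu) (nu') (g) => x y z; ring.
    have -> : nu' ^+ (5 * I).+1 * (mu * h) = nu' ^+ (5 * I) * h * (mu * nu').
      by rewrite exprS; move: (mu) (nu') (h) => x y z; ring.
    by rewrite mu_nu !mulr1 mulrDr.
  - rewrite ev_cons /ev map_polyC hornerC !rmorphN !rmorph_nat.
    transitivity ((W * ((1 + t) * (1 - t))) ^+ 2 * (W + (W * t ^+ 2) *+ 3) *+ 2).
      by rewrite W_inv Wt2; move: W => y; ring.
    by rewrite /nu' /mu /g /h; move: W t => y z; ring.
  - rewrite mulrA mu_nu mul1r [nu' * _]mulrA [nu' * mu]mulrC mu_nu mul1r.
    rewrite !ev_cons /ev map_polyC hornerC !rmorphN !rmorph_nat /=.
    transitivity ((W ^+ 2 + W * (W * t ^+ 2) *+ 12 + (W * t ^+ 2) ^+ 2 *+ 3) *+ 2).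
      by rewrite Wt2; move: W => y; ring.
    by rewrite /g /h; move: W t => y z; ring.
pose g := W ^+ 1 * ((1 - t) ^+ 2 * (1 + t *+ 3)).
pose h := W ^+ 1 * ((1 + t) ^+ 2 * (1 - t *+ 3)).
have gh : rescale (-1) g = h by rewrite rM rescale_W rb rt.
have -> : kap ^+ (0 + 2 * I) * eta_xi = W ^+ (5 * I + 1) * (mu ^+ (5 * I) * g).
  rewrite [X in _ * X = _]xi_t add0n K2 exprD /g.
  move: (W ^+ (5 * I)) (mu ^+ _) W t => x y z u; ring.
rewrite rM rescale_W rescale_mu gh evXnM -mulrnAr.
rewrite (zrec_ev (g := g) (h := h)) ?mulrDr //.
- rewrite ev_cons /ev map_polyC hornerC /= !rmorphN !rmorph_nat.
  transitivity ((W - (W * t ^+ 2) *+ 5) *+ 2); last first.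
    by rewrite /g /h; move: W t => y z; ring.
  by rewrite Wt2; move: W => y; ring.
- rewrite /ev map_polyC hornerC /= rmorph1.
  transitivity ((W * ((1 + t) * (1 - t))) ^+ 2 *+ 2); first by rewrite W_inv expr1n.
  by rewrite /mu /nu' /g /h; move: W t => y z; ring.
Qed.

(** At the exponent [2 n] both summands of [ev_zpoly] have the same coefficient, so the 2 cancels;
    the left side is a series in [q^2], read at [q^n]. *)
Lemma zpoly_rep i : zeta_rep i 1 (zpoly i).
Proof.
move=> n; rewrite evE xiE !sExpE expr1.
have := congr1 (fun f : fps int => f (2 * n)%N) (ev_zpoly i).
rewrite mulr2n !fps_coefD -dil_ev /dil dvdn_mulr // mulKn //.
rewrite /rescale exprM sqrrN !expr1n mul1r.
rewrite -[sU _ n]/((kap ^+ i * eta_xi) (2 * n)%N).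
move: (ev _ _ n) ((kap ^+ i * eta_xi) _) => x y; lia.
Qed.

Lemma zeta_rep_uniq i p : zeta_rep i 1 p -> p = zpoly i.
Proof.
move=> zp; apply: ev_xi_inj; apply: funext => n.
by rewrite -xiE -!evE -zp zpoly_rep.
Qed.
End Evaluation.

(** * Valuations *)

Lemma nu_odd n : (2 %| n)%Z = false -> nu n = Some 0%N.
Proof.
rewrite /nu dvdzE; case: eqP => [->|_] //= n2; congr Some.
by rewrite logn_coprime // prime_coprime // n2.
Qed.

Lemma nu_geP n k : (2%:Z ^+ k %| n)%Z -> nu_ge n k.
Proof.
rewrite /nu_ge /nu; case: eqP => // /eqP n0; rewrite dvdzE abszX => d.
by rewrite -pfactor_dvdn ?absz_gt0.
Qed.

Lemma nu_eq1 n : (4 %| n - 2)%Z -> nu n = Some 1%N.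
Proof.
move=> /dvdzP[c e]; have {e} -> : n = 2 * (2 * c + 1) by lia.
rewrite /nu; case: eqP => [|_]; first lia.
rewrite abszM lognM; [|lia|lia]; rewrite (_ : logn 2 (absz 2) = 1%N) //.
suff -> : logn 2 (absz (2 * c + 1)) = 0%N by [].
by rewrite logn_coprime // prime_coprime //; lia.
Qed.

Lemma coef_step (p0 p1 : {poly int}) M :
  ((4%:P * 'X - 2%:P) * p1 - p0)`_M =
  4 * (if M is M'.+1 then p1`_M' else 0) - 2 * p1`_M - p0`_M.
Proof.
rewrite coefB mulrBl coefB -mulrA !coefCM coefXM.
by case: M.
Qed.

(** A polynomial in [4 X] with odd constant term. The multiplier [4 X - 2] is a polynomial in [4 X]
    with even constant term, so the recurrence keeps this shape. *)
Definition even_inv (p : {poly int}) : Prop :=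
  (forall M, (4%:Z ^+ M %| p`_M)%Z) /\ (2 %| p`_0)%Z = false.

Lemma zrec_even p0 p1 k : even_inv p0 -> even_inv p1 -> even_inv (zrec p0 p1 k).
Proof.
elim: k p0 p1 => [|k IH] p0 p1 // i0 i1; apply: IH => //.
have [d0 o0] := i0; have [d1 o1] := i1; split=> [M|]; last by rewrite coef_step; lia.
rewrite coef_step !rpredB //; last by rewrite dvdz_mull.
case: M => [|M]; first by rewrite mulr0 dvdz0.
by rewrite exprS dvdz_mul.
Qed.

(** The coefficient -18 in the initial values lets only [2 p] be a polynomial in [4 X]; the class of
    the coefficient of ['X] modulo 4 is therefore tracked by [b]. *)
Definition odd_inv (b : bool) (p : {poly int}) : Prop :=
  [/\ forall M, (4%:Z ^+ M %| 2 * p`_M)%Z, (2 %| p`_0)%Z = false &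
      (4 %| p`_1 - 2 * b%:Z)%Z].

(* [b] is the parity of an index: the coefficient of ['X] is 2 modulo 4 at one
   parity and 0 modulo 4 at the other. *)
Lemma zrec_odd b p0 p1 k : odd_inv b p0 -> odd_inv (~~ b) p1 ->
  odd_inv (b (+) odd k) (zrec p0 p1 k).
Proof.
elim: k b p0 p1 => [|k IH] b p0 p1 i0 i1; first by rewrite addbF.
rewrite [odd _]/= addbN -addNb; apply: IH => //; rewrite negbK.
have [d0 o0 s0] := i0; have [d1 o1 s1] := i1; split=> [M||]; last 2 first.
- by rewrite coef_step; lia.
- by rewrite coef_step; case: b {i0 i1} s0 s1 => /=; lia.
rewrite coef_step mulrBr mulrBr !rpredB //; last first.
  by rewrite mulrCA dvdz_mull.
case: M => [|M]; first by rewrite !mulr0 dvdz0.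
by rewrite mulrCA exprS dvdz_mul.
Qed.

Lemma coef_cons (R : nzRingType) (p : {poly R}) c M :
  (p * 'X + c%:P)`_M = if M is M'.+1 then p`_M' else c.
Proof. by rewrite coefD coefMX coefC; case: M => [|M] /=; rewrite ?add0r ?addr0. Qed.

Theorem theorem4p3 (i : nat) :
  (exists p : {poly int}, zeta_rep i 1 p) /\
  forall p : {poly int}, zeta_rep i 1 p ->
    [/\ nu p`_(d_ij i 1) = Some 0%N,
        (if (i %% 4 == 1)%N then nu p`_(d_ij i 1 + 1) = Some 1%N
         else nu_ge p`_(d_ij i 1 + 1) 2)
      & forall M : nat, (2 <= M)%N -> nu_ge p`_(d_ij i 1 + M) M.+1].
Proof.
(* By uniqueness [p] is [zpoly i], whose coefficient at [d_ij i 1 + M] is coefficient [M] of the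
   [zrec] factor. *)
split=> [|p /zeta_rep_uniq ->]; first by exists (zpoly i); apply: zpoly_rep.
have shift d r M : ('X^d * r : {poly int})`_(d + M) = r`_M.
  by rewrite coefXnM ltnNge leq_addr /= addKn.
have shift0 d r : ('X^d * r : {poly int})`_d = r`_0 by have := shift d r 0%N; rewrite addn0.
rewrite /zpoly /d_ij; case: ifP => oi /=.
  rewrite !addn0 shift0 !shift.
  set r := zrec _ _ _.
  have [d o s] : odd_inv (false (+) odd (5 * i./2).+1) r.
    apply: zrec_odd; split=> [[|[|[|M]]]||]; rewrite ?coef_cons ?coefC //=.
  (* For [i = 2 I + 1], the index [5 I + 1] is odd exactly when [I] is even, that is when [i] is 1
     modulo 4. *)
  rewrite [odd _]/= oddM /= in s.
  split; first exact: nu_odd.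
    have := odd_double_half i; rewrite oi; move: s.
    case: eqP => [i1|i1] s ii.
      apply: nu_eq1; move: s.
      by have -> : odd i./2 = false by lia.
    apply: nu_geP; move: s; have -> : odd i./2 by lia.
    by rewrite subr0.
  move=> M M2; rewrite shift; apply: nu_geP.
  (* Cancelling the 2 in [odd_inv] leaves [2^(2 M - 1)], and [2 M - 1 >= M + 1] for [M >= 2]. *)
  have := d M; rewrite (_ : 4%:Z ^+ M = 2 * 2%:Z ^+ M.+1 * 2%:Z ^+ (M - 2)).
    by rewrite -!mulrA dvdz_mul2l //= => /(dvdz_trans _); apply; apply: dvdz_mulr.
  have -> : 4%:Z = 2%:Z ^+ 2 by [].
  by rewrite -exprM -exprS -exprD; congr (_ ^+ _); lia.
rewrite !addn0 shift0 !shift.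
set r := zrec _ _ _.
have [d o] : even_inv r.
  by apply: zrec_even; split=> [[|[|M]]|]; rewrite ?coef_cons ?coefC //= dvdz0.
split; first exact: nu_odd.
  case: eqP => [i1|_]; first by lia.
  by apply: nu_geP; apply: d.
move=> M M2; rewrite shift; apply: nu_geP; apply: dvdz_trans (d M).
have -> : 4%:Z = 2%:Z ^+ 2 by [].
by rewrite -exprM; apply: dvdz_exp2l; lia.
Qed.
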